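(* Let $M$ be a $\mathbb{Z}^k$-graded $R$-module and let $\mu\in\mathbb{Z}^k$ with $\mu\notin \mathbb{C}_B(M)^*$. Then for any $t\in \mu+(n_1-1,\dots,n_k-1)+\mathbb{N}^k$ such that $M_{t+\mathbb{N}^k}\neq 0$, one has $$\operatorname{reg}(M_{t+\mathbb{N}^k})=|t|.$$
   Context: $S$ is an arbitrary commutative unitary ring, $k\ge 1$, $n_1,\dots,n_k\ge 1$, and $R=S[X_{i,j} : 1\le i\le k,\ 1\le j\le n_i]$ with its standard $\mathbb{Z}^k$-grading: elements of $S$ have degree $0$ and $\deg X_{i,j}=e_i$, the $i$-th canonical generator of $\mathbb{Z}^k$. $B_i=(X_{i,1},\dots,X_{i,n_i})$ and $B=B_1\cap\cdots\cap B_k=B_1\cdots B_k$; $\mathfrak{m}=B_1+\cdots+B_k$. Modules are not assumed finitely generated. For a finitely generated homogeneous ideal $I$, $H^i_I(M)$ is the $i$-th cohomology of the Čech complex of $M$ with respect to a finite homogeneous generating set of $I$. $\mathbb{C}_I(M)=\{\gamma\in\mathbb{Z}^k : H^i_I(M)_\gamma\ne 0 \text{ for some } i\}$. For $E\subseteq\mathbb{Z}^k$, $E^*=E-\mathbb{N}^k=\{e-\nu : e\in E,\ \nu\in\mathbb{N}^k\}$, with $\mathbb{N}=\mathbb{Z}_{\ge0}$. For $t\in\mathbb{Z}^k$, $M_{t+\mathbb{N}^k}=\bigoplus_{\nu\in t+\mathbb{N}^k}M_\nu$ (a graded submodule of $M$) and $|t|=t_1+\cdots+t_k$. A $\mathbb{Z}^k$-graded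 module $N$ is also $\mathbb{Z}$-graded by total degree ($N_d=\bigoplus_{|\nu|=d}N_\nu$), and $\operatorname{reg}(N)$ is its Castelnuovo-Mumford regularity for this grading over the standard $\mathbb{Z}$-graded polynomial ring $R$: $\operatorname{reg}(N)=\sup\{i+d : H^i_{\mathfrak{m}}(N)_d\neq 0\}$. *)

(* Defs.v *)
From HB Require Import structures.
From mathcomp Require Import all_boot all_order all_algebra.
From mathcomp Require Import boolp classical_sets.
From mathcomp Require Import mpoly ring.

Set Implicit Arguments.
Unset Strict Implicit.
Unset Printing Implicit Defensive.

Import Order.TTheory GRing.Theory Num.Theory.
Local Open Scope ring_scope.
Local Open Scope quotient_scope.
Local Open Scope classical_set_scope.

Section Localization.
Context (A : comNzRingType) (M : lmodType A) (g : A).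

(* [(m, e)] stands for the fraction m / g^e; [g] may be a zero divisor or
   nilpotent, hence the extra power of [g]. *)
Definition loc_rel (x y : M * nat) : Prop :=
  exists N : nat, g ^+ (N + y.2) *: x.1 = g ^+ (N + x.2) *: y.1.

Definition loc_eq (x y : M * nat) : bool := `[< loc_rel x y >].

Lemma loc_eq_equiv : equiv_class_of loc_eq.
Proof.
split=> [x|x y|y x z]; first by apply/asboolP; exists 0%N.
  by apply/asboolP/asboolP => -[N e]; exists N.
move=> /asboolP [N exy] /asboolP [K eyz]; apply/asboolP.
exists (N + K + y.2)%N.
have -> : (N + K + y.2 + z.2 = (K + z.2) + (N + y.2))%N by ring.
rewrite exprD -scalerA exy scalerA -exprD.
have -> : (K + z.2 + (N + x.2) = (N + x.2) + (K + z.2))%N by ring.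
rewrite exprD -scalerA eyz scalerA -exprD.
by congr (g ^+ _ *: _); ring.
Qed.

Canonical loc_equiv := EquivRelPack loc_eq_equiv.

Definition loc := {eq_quot loc_equiv}.

HB.instance Definition _ := Choice.on loc.
HB.instance Definition _ := EqQuotient.on loc.

Definition frac (m : M) (e : nat) : loc := \pi_loc (m, e).

Lemma fracP m e m' e' :
  frac m e = frac m' e' <->
  exists N : nat, g ^+ (N + e') *: m = g ^+ (N + e) *: m'.
Proof. by split=> [/eqmodP/asboolP//|h]; apply/eqmodP/asboolP. Qed.

Lemma frac_ind (P : loc -> Prop) : (forall m e, P (frac m e)) -> forall x, P x.
Proof. by move=> h x; rewrite -[x]reprK; case: (repr x). Qed.

Definition loc_zero : loc := frac 0 0.
Definition loc_opp (x : loc) : loc := frac (- (repr x).1) (repr x).2.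
Definition loc_add (x y : loc) : loc :=
  frac (g ^+ (repr y).2 *: (repr x).1 + g ^+ (repr x).2 *: (repr y).1)
       ((repr x).2 + (repr y).2).
Definition loc_scale (a : A) (x : loc) : loc :=
  frac (a *: (repr x).1) (repr x).2.

Lemma repr_frac m e : exists N : nat,
  g ^+ (N + e) *: (repr (frac m e)).1 = g ^+ (N + (repr (frac m e)).2) *: m.
Proof.
by apply/fracP; rewrite -[RHS](reprK (frac m e)); case: (repr (frac m e)).
Qed.

Let scaleE (a b : nat) (m : M) : g ^+ a *: (g ^+ b *: m) = g ^+ (a + b) *: m.
Proof. by rewrite scalerA exprD. Qed.

Lemma loc_oppE m e : loc_opp (frac m e) = frac (- m) e.
Proof.
have [N h] := repr_frac m e; apply/fracP; exists N.
by rewrite !scalerN h.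
Qed.

Lemma loc_scaleE a m e : loc_scale a (frac m e) = frac (a *: m) e.
Proof.
have [N h] := repr_frac m e; apply/fracP; exists N.
by rewrite !scalerA ![_ * a]mulrC -!scalerA h.
Qed.

Lemma loc_addE m e m' e' :
  loc_add (frac m e) (frac m' e') = frac (g ^+ e' *: m + g ^+ e *: m') (e + e').
Proof.
have [N h] := repr_frac m e; have [N' h'] := repr_frac m' e'.
rewrite /loc_add.
case: (repr (frac m e)) h => [u a] /= h.
case: (repr (frac m' e')) h' => [v b] /= h'.
apply/fracP; exists (N + N')%N; rewrite !scalerDr !scaleE; congr (_ + _).
  have -> : (N + N' + (e + e') + b = (N' + e' + b) + (N + e))%N by ring.
  rewrite -scaleE h scaleE; congr (g ^+ _ *: _); ring.
have -> : (N + N' + (e + e') + a = (N + e + a) + (N' + e'))%N by ring.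
rewrite -scaleE h' scaleE; congr (g ^+ _ *: _); ring.
Qed.


Let loc_addA : associative loc_add.
Proof.
elim/frac_ind=> m e; elim/frac_ind=> m' e'; elim/frac_ind=> m'' e''.
rewrite !loc_addE !scalerDr !scaleE addnA addrA.
by rewrite (addnC e'' e') (addnC e'' e).
Qed.

Let loc_addC : commutative loc_add.
Proof.
by elim/frac_ind=> m e; elim/frac_ind=> m' e'; rewrite !loc_addE addrC addnC.
Qed.

Let loc_add0 : left_id loc_zero loc_add.
Proof.
by elim/frac_ind=> m e; rewrite loc_addE scaler0 add0r expr0 scale1r.
Qed.

Lemma frac0 e : frac 0 e = loc_zero.
Proof. by apply/fracP; exists 0%N; rewrite !scaler0. Qed.

Let loc_addN : left_inverse loc_zero loc_opp loc_add.
Proof.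
by elim/frac_ind=> m e; rewrite loc_oppE loc_addE scalerN addNr frac0.
Qed.

HB.instance Definition _ :=
  GRing.isZmodule.Build loc loc_addA loc_addC loc_add0 loc_addN.

Lemma fracD m e m' e' :
  frac m e + frac m' e' = frac (g ^+ e' *: m + g ^+ e *: m') (e + e').
Proof. exact: loc_addE. Qed.

Lemma frac_factor c m e : frac (g ^+ c *: m) (c + e) = frac m e.
Proof.
by apply/fracP; exists 0%N; rewrite scaleE; congr (g ^+ _ *: _); ring.
Qed.

Let loc_scaleA a b x : loc_scale a (loc_scale b x) = loc_scale (a * b) x.
Proof. by elim/frac_ind: x => m e; rewrite !loc_scaleE scalerA. Qed.

Let loc_scale1 : left_id 1 loc_scale.
Proof. by elim/frac_ind=> m e; rewrite loc_scaleE scale1r. Qed.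

Let loc_scaleDr : right_distributive loc_scale +%R.
Proof.
move=> a; elim/frac_ind=> m e; elim/frac_ind=> m' e'.
by rewrite fracD !loc_scaleE fracD scalerDr !scalerA ![a * _]mulrC.
Qed.

Let loc_scaleDl x : {morph loc_scale^~ x : a b / a + b}.
Proof.
move=> a b; elim/frac_ind: x => m e; rewrite !loc_scaleE fracD.
by rewrite -scalerDr -scalerDl frac_factor.
Qed.

HB.instance Definition _ := GRing.Zmodule_isLmodule.Build A loc
  loc_scaleA loc_scale1 loc_scaleDr loc_scaleDl.

End Localization.

Arguments frac {A M} g m e.
Arguments frac_ind {A M g}.

(* The canonical map M_g -> M_(h g), m / g^e |-> (h^e m) / (h g)^e.  The target
   g' is kept separate from h * g because in the Cech complex the two are only
   propositionally equal; see loc_mapE. *)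
Definition loc_map (A : comNzRingType) (M : lmodType A) (g g' h : A)
    (x : loc M g) : loc M g' :=
  frac g' (h ^+ (repr x).2 *: (repr x).1) (repr x).2.

Lemma loc_mapE (A : comNzRingType) (M : lmodType A) (g g' h : A) (m : M) e :
  g' = h * g -> loc_map g' h (frac g m e) = frac g' (h ^+ e *: m) e.
Proof.
move=> ->; have [N E] := repr_frac g m e; apply/fracP; exists N.
case: (repr _) E => [u a] /= E.
rewrite !scalerA !exprMn.
have -> : h ^+ (N + e) * g ^+ (N + e) * h ^+ a = h ^+ (N + e + a) * g ^+ (N + e).
  by rewrite [h ^+ (_ + a)]exprD; ring.
have -> : h ^+ (N + a) * g ^+ (N + a) * h ^+ e = h ^+ (N + e + a) * g ^+ (N + a).
  by rewrite !exprD; ring.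
by rewrite -!scalerA E.
Qed.

Section Cech.
Context (A : comNzRingType) (M : lmodType A) (r : nat) (f : 'I_r -> A).

Definition subprod (J : {set 'I_r}) : A := \prod_(j in J) f j.

Lemma subprodD1 (J : {set 'I_r}) j : j \in J ->
  subprod J = f j * subprod (J :\ j)%SET.
Proof.
move=> jJ; rewrite /subprod (bigD1 j)//=; congr (_ * _).
by apply: eq_bigl => i; rewrite !inE andbC.
Qed.

(* The p-cochains are the families (c_J) with #|J| = p; all cohomological
   degrees are bundled together, and degree p only looks at the sets of size
   p.  In particular the term of degree 0 is M, and f is indexed in increasing
   order by 'I_r. *)
Definition cochain := forall J : {set 'I_r}, loc M (subprod J).

Definition cech_d (c : cochain) : cochain := fun J =>
  \sum_(j in J)
    (-1) ^+ #|[set i in J | (i < j)%N]| *: loc_map _ (f j) (c (J :\ j)%SET).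

Definition cocycle (p : nat) (c : cochain) : Prop :=
  forall J : {set 'I_r}, #|J| = p.+1 -> cech_d c J = 0.

Definition coboundary (p : nat) (c : cochain) : Prop :=
  exists b : cochain, forall J : {set 'I_r}, #|J| = p -> c J = cech_d b J.

End Cech.

Section DirectSum.
Context (G V : zmodType) (V_ : G -> set V).

Definition hsum (P : set G) : set V :=
  [set x | exists s : seq G, exists2 f : G -> V,
     (forall g, g \in s -> P g /\ V_ g (f g)) & x = \sum_(g <- s) f g].

Record direct_decomposition : Prop := DirectDecomposition {
  dd0 : forall g, V_ g 0;
  ddB : forall g x y, V_ g x -> V_ g y -> V_ g (x - y);
  dd_sum : forall x, hsum setT x;
  dd_indep : forall (s : seq G) (f : G -> V), uniq s ->
    (forall g, g \in s -> V_ g (f g)) -> \sum_(g <- s) f g = 0 ->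
    forall g, g \in s -> f g = 0 }.

Context (V0 : forall g, V_ g 0).
Context (VB : forall g x y, V_ g x -> V_ g y -> V_ g (x - y)).

Lemma subgroup_sum g (I : eqType) (r : seq I) (Q : pred I) (h : I -> V) :
  (forall i, i \in r -> Q i -> V_ g (h i)) -> V_ g (\sum_(i <- r | Q i) h i).
Proof.
move=> hV; rewrite big_seq_cond; elim/big_ind: _ => //.
  by move=> x y hx hy; rewrite -[y]opprK -[- y]sub0r; apply: VB => //; exact: VB.
by move=> i /andP[]; exact: hV.
Qed.

Lemma hsum_family (P : set G) (I : eqType) (r : seq I) (d : I -> G) (h : I -> V) :
  (forall i, i \in r -> P (d i) /\ V_ (d i) (h i)) ->
  exists s : seq G, exists f : G -> V,
    [/\ uniq s, forall g, g \in s -> P g /\ V_ g (f g)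
      & \sum_(i <- r) h i = \sum_(g <- s) f g].
Proof.
move=> hP; exists (undup [seq d i | i <- r]).
exists (fun g => \sum_(i <- r | d i == g) h i); split; first exact: undup_uniq.
  move=> g; rewrite mem_undup => /mapP[i ir ->]; split; first by case: (hP i ir).
  by apply: subgroup_sum => j jr /eqP <-; case: (hP j jr).
rewrite (exchange_big_dep predT)//= [LHS]big_seq [RHS]big_seq.
apply: eq_bigr => i ir.
rewrite -big_filter (_ : [seq g <- _ | _] = [:: d i]) ?big_seq1//.
rewrite -[RHS](filter_pred1_uniq (undup_uniq [seq d j | j <- r])).
  by apply: eq_filter => g; rewrite /= eq_sym.
by rewrite mem_undup map_f.
Qed.

Lemma hsum_intro (P : set G) (I : eqType) (r : seq I) (d : I -> G) (h : I -> V) :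
  (forall i, i \in r -> P (d i) /\ V_ (d i) (h i)) ->
  hsum P (\sum_(i <- r) h i).
Proof. by move=> /hsum_family[s [f [_ hf ->]]]; exists s; exists f. Qed.

Lemma hsum_uniq (P : set G) x : hsum P x ->
  exists s : seq G, exists f : G -> V,
    [/\ uniq s, forall g, g \in s -> P g /\ V_ g (f g) & x = \sum_(g <- s) f g].
Proof. by case=> s [f hf ->]; exact: (@hsum_family P G s id f hf). Qed.

Lemma hsum1 (P : set G) g x : P g -> V_ g x -> hsum P x.
Proof.
move=> Pg Vx; exists [:: g]; exists (fun=> x); last by rewrite big_seq1.
by move=> g'; rewrite inE => /eqP->.
Qed.

Lemma hsum0 (P : set G) : hsum P 0.
Proof. by exists [::]; exists (fun=> 0); rewrite ?big_nil. Qed.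

Lemma hsumB (P : set G) x y : hsum P x -> hsum P y -> hsum P (x - y).
Proof.
case=> s [f hf ->] [s' [f' hf' ->]].
pose d (i : G + G) := match i with inl g => g | inr g => g end.
pose h (i : G + G) := match i with inl g => f g | inr g => - f' g end.
have -> : \sum_(g <- s) f g - \sum_(g <- s') f' g =
    \sum_(i <- map inl s ++ map inr s') h i.
  by rewrite big_cat !big_map -sumrN.
apply: (hsum_intro (d := d)) => i; rewrite mem_cat => /orP[] /mapP[g gs ->] /=.
  exact: hf.
case: (hf' g gs) => Pg Vg; split=> //; rewrite -sub0r; exact: VB.
Qed.

End DirectSum.

(* The polynomial ring is graded by giving the v-th variable degree w v and the
   scalars degree 0. *)
Definition mdegree (G : zmodType) (N : nat) (w : 'I_N -> G) (m : 'X_{1..N}) : G :=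
  \sum_(v < N) w v *+ m v.

Definition homogeneous (S : comNzRingType) (G : zmodType) (N : nat) (w : 'I_N -> G)
    (d : G) (p : {mpoly S[N]}) : Prop :=
  forall m, m \in msupp p -> mdegree w m = d.

Record gradedModule (S : comNzRingType) (G : zmodType) (N : nat) (w : 'I_N -> G) :=
  GradedModule {
    gmod :> lmodType {mpoly S[N]};
    hcomp : G -> set gmod;
    hcompP : direct_decomposition hcomp;
    hcompZ : forall d g (p : {mpoly S[N]}) (x : gmod),
      homogeneous w d p -> hcomp g x -> hcomp (d + g) (p *: x) }.

Arguments hcomp {S G N w} M g : rename.

Lemma hsumZ (S : comNzRingType) (G : zmodType) (N : nat) (w : 'I_N -> G)
    (M : gradedModule S w) (P Q : set G) (p : {mpoly S[N]}) (x : M) :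
  (forall m g, m \in msupp p -> P g -> Q (mdegree w m + g)) ->
  hsum (hcomp M) P x -> hsum (hcomp M) Q (p *: x).
Proof.
move=> hPQ [s [f hf ->]].
have h0 := dd0 (hcompP M); have hB := ddB (hcompP M).
rewrite [p in p *: _]mpolyE scaler_suml.
apply: (@subgroup_sum G M (fun=> hsum (hcomp M) Q) _ _ 0 _ _ predT).
- by move=> _; exact: hsum0.
- by move=> _ y z; exact: hsumB.
move=> m mp _.
rewrite scaler_sumr; apply: (hsum_intro h0 hB (d := fun g => mdegree w m + g)).
move=> g gs; have [Pg Mg] := hf g gs; split; first exact: hPQ.
apply: hcompZ Mg => m'; rewrite -mul_mpolyC => /msuppM_le/allpairsP[[a b] /= []].
rewrite msuppX inE => ha /eqP -> ->.
by move: ha; rewrite msuppC; case: ifP => //= _; rewrite inE => /eqP->; rewrite add0m.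
Qed.

Section Coarsen.
Context (G H : zmodType).

Section Group.
Context (V : zmodType) (V_ : G -> set V) (phi : G -> H).

Definition coarse (h : H) : set V := hsum V_ [set g | phi g = h].

Lemma coarse_dd : direct_decomposition V_ -> direct_decomposition coarse.
Proof.
case=> h0 hB hs hi; split.
- by move=> h; exact: hsum0.
- by move=> h x y; exact: hsumB.
- move=> x; have [s [f hf ->]] := hs x.
  apply: (hsum_intro _ _ (d := phi)) => [h|h y z|g gs]; first exact: hsum0.
    exact: hsumB.
  by split=> //; apply: (hsum1 (g := g)) => //; case: (hf g gs).
- move=> s f us hf sf0 h hs'.
  have /choice[D hD] : forall h, exists D : seq G * (G -> V), h \in s ->
      [/\ uniq D.1, forall g, g \in D.1 -> phi g = h /\ V_ g (D.2 g)
        & f h = \sum_(g <- D.1) D.2 g].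
    move=> h1; have [h1s|] := boolP (h1 \in s); last by exists ([::], fun=> 0).
    by have [t [F hF]] := hsum_uniq h0 hB (hf h1 h1s); exists (t, F).
  pose F g := (D (phi g)).2 g.
  have fE h1 : h1 \in s -> f h1 = \sum_(g <- (D h1).1) F g.
    move=> h1s; have [_ hg ->] := hD _ h1s; rewrite [LHS]big_seq [RHS]big_seq.
    by apply: eq_bigr => g /hg[<-].
  pose T := flatten [seq (D h1).1 | h1 <- s].
  have uT : uniq T.
    rewrite /T; elim: (s) us (hD) => //= a l IH /andP[al ul] hDl.
    have [ua ha _] := hDl a (mem_head _ _).
    rewrite cat_uniq ua IH// => [|h1 h1l]; last first.
      by apply: hDl; rewrite inE h1l orbT.
    rewrite andbT; apply/hasPn => g /flatten_mapP[b bl gb]; apply/negP => ga.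
    have [_ hb _] := hDl b (mem_behead (s := a :: l) bl).
    by move: al; rewrite -(ha g ga).1 (hb g gb).1 bl.
  have F0 : forall g, g \in T -> F g = 0.
    apply: hi => // [g /flatten_mapP[a al ga]|].
      by have [_ /(_ g ga)[<- ?]] := hD a al.
    rewrite /T big_flatten big_map -[RHS]sf0 [LHS]big_seq [RHS]big_seq.
    by apply: eq_bigr => a al; rewrite fE.
  rewrite fE// big_seq big1// => g gD; apply: F0.
  by apply/flatten_mapP; exists h.
Qed.
End Group.

Context (S : comNzRingType) (N : nat) (w : 'I_N -> G) (w' : 'I_N -> H).
Context (phi : {additive G -> H}) (phiw : forall v, phi (w v) = w' v).
Context (M : gradedModule S w).

Lemma coarseZ d h (p : {mpoly S[N]}) (x : M) :
  homogeneous w' d p -> coarse (hcomp M) phi h x ->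
  coarse (hcomp M) phi (d + h) (p *: x).
Proof.
move=> hp; apply: hsumZ => m g mp /= <-; rewrite raddfD -(hp m mp); congr (_ + _).
by rewrite raddf_sum; apply: eq_bigr => v _; rewrite raddfMn phiw.
Qed.

Definition coarsen : gradedModule S w' :=
  GradedModule (coarse_dd phi (hcompP M)) coarseZ.

End Coarsen.

Section Restriction.
Context (S : comNzRingType) (G : zmodType) (N : nat) (w : 'I_N -> G).
Context (M : gradedModule S w) (P : set G).
Context (hP : forall v g, P g -> P (w v + g)).

(* The unused argument only makes hP recoverable from the predicate, for the
   canonical submodule instance. *)
Definition in_restr of (forall v g, P g -> P (w v + g)) : {pred M} :=
  fun x => `[< hsum (hcomp M) P x >].

Lemma restr_submod : submod_closed (in_restr hP).
Proof.
have h0 := dd0 (hcompP M); have hB := ddB (hcompP M).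
split; first by apply/asboolP; exact: hsum0.
move=> p x y /asboolP hx /asboolP hy; apply/asboolP.
rewrite -[y]opprK -[- y]sub0r; apply: hsumB => //; last first.
  by apply: hsumB => //; exact: hsum0.
apply: hsumZ hx => m g _; rewrite /mdegree.
elim/big_rec: _ => [|v e _ IH Pg]; first by rewrite add0r.
rewrite -addrA; move: (IH Pg); move: (_ + g) => g'.
elim: (m v) => [|n IHn] Pg'; first by rewrite mulr0n add0r.
by rewrite mulrS -addrA; apply: hP; exact: IHn.
Qed.

HB.instance Definition _ :=
  GRing.isSubmodClosed.Build {mpoly S[N]} M (in_restr hP) restr_submod.

Record restr_type := RestrType {
  restr_val : M; restr_valP : restr_val \in in_restr hP }.

HB.instance Definition _ := [isSub for restr_val].
HB.instance Definition _ := [Choice of restr_type by <:].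
HB.instance Definition _ := [SubChoice_isSubLmodule of restr_type by <:].

Definition restr_comp (g : G) : set restr_type :=
  [set x | hcomp M g (val x)].

Lemma restr_dd : direct_decomposition restr_comp.
Proof.
have [h0 hB hs hi] := hcompP M.
split.
- by move=> g; change (hcomp M g (val (0 : restr_type))); rewrite raddf0; exact: h0.
- move=> g x y hx hy; change (hcomp M g (val (x - y))).
  by rewrite raddfB; exact: hB.
- move=> x; have /asboolP[s [f hf xE]] := restr_valP x.
  have fin g : g \in s -> f g \in in_restr hP.
    by move=> gs; have [Pg Mg] := hf g gs; apply/asboolP; exact: hsum1 Mg.
  exists s; exists (fun g => insubd (0 : restr_type) (f g)).
    move=> g gs; split=> //; rewrite /restr_comp.
    by change (hcomp M g (val (insubd (0 : restr_type) (f g)))); rewrite (insubdK 0 (fin g gs)); case: (hf g gs).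
  apply: val_inj; rewrite raddf_sum /= xE [LHS]big_seq [RHS]big_seq.
  by apply: eq_bigr => g gs; rewrite insubdK ?fin.
- move=> s f us hf sf0 g gs; apply: val_inj; rewrite raddf0.
  apply: (hi s (fun g => val (f g))) => //.
  by rewrite -raddf_sum sf0 raddf0.
Qed.

Lemma restr_compZ d g (p : {mpoly S[N]}) (x : restr_type) :
  homogeneous w d p -> restr_comp g x -> restr_comp (d + g) (p *: x).
Proof. by move=> hp hx; change (hcomp M (d + g) (val (p *: x))); rewrite linearZ; exact: hcompZ. Qed.

Definition restr : gradedModule S w := GradedModule restr_dd restr_compZ.

End Restriction.

Section LocalCohomology.
Context (S : comNzRingType) (G : zmodType) (N : nat) (w : 'I_N -> G).
Local Notation R := {mpoly S[N]}.

Definition homogeneous_generators (I : set R) (r : nat) (f : 'I_r -> R) : Prop :=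
  (forall i, exists d, homogeneous w d (f i)) /\
  I = [set p | exists a : 'I_r -> R, p = \sum_(i < r) a i * f i].

Context (M : gradedModule S w).

(* x / a^e has degree deg x - e deg a. *)
Definition loc_hcomp (a : R) (g : G) : set (loc M a) :=
  [set y | exists d x e,
     [/\ homogeneous w d a, hcomp M (d *+ e + g) x & y = frac a x e]].

Context (r : nat) (f : 'I_r -> R).

(* The degree g part of the p-th cohomology of the Cech complex of M with
   respect to f is nonzero, i.e. some homogeneous cocycle of degree g is not a
   coboundary. *)
Definition local_cohomology_neq0 (p : nat) (g : G) : Prop :=
  exists c : cochain M f,
    [/\ forall J : {set 'I_r}, #|J| = p -> loc_hcomp g (c J),
        cocycle p c
      & ~ coboundary p c].

Definition cohomology_support : set G :=
  [set g | exists p, local_cohomology_neq0 p g].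

End LocalCohomology.

(* reg(N) = c for an integer c: a supremum in Z exists only when the set is
   nonempty and bounded above, i.e. when reg(N) is finite. *)
Definition regularity_is (S : comNzRingType) (N r : nat)
    (M : gradedModule S (fun _ : 'I_N => 1 : int)) (f : 'I_r -> {mpoly S[N]})
    (c : int) : Prop :=
  supremums [set e | exists p d, local_cohomology_neq0 M f p d /\ e = p%:Z + d] c.

Section Standard.
Context (S : comNzRingType) (k : nat) (n : 'I_k -> nat).

(* Variables are indexed by pairs (i, j) with i < k and j < n i, flattened to
   'I_(\sum_i n i) by tagnat.Rank. *)
Definition stdring := {mpoly S[\sum_(i < k) n i]}.

Definition Xvar (i : 'I_k) (j : 'I_(n i)) : stdring := 'X_(tagnat.Rank i j).

Definition multideg (v : 'I_(\sum_(i < k) n i)) : 'rV[int]_k :=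
  delta_mx 0 (tagnat.sig1 v).

Definition block_ideal (i : 'I_k) : set stdring :=
  [set p | exists a : 'I_(n i) -> stdring, p = \sum_(j < n i) a j * Xvar j].

Definition B_ideal : set stdring := \bigcap_(i in [set: 'I_k]) block_ideal i.

Definition m_ideal : set stdring :=
  [set p | exists2 b : 'I_k -> stdring,
     forall i, block_ideal i (b i) & p = \sum_(i < k) b i].

End Standard.

Arguments Xvar S {k n i} j.
Arguments multideg {k} n v.
Arguments block_ideal S {k} n i _.
Arguments B_ideal S {k} n _.
Arguments m_ideal S {k} n _.

Definition Nvec (k : nat) : set 'rV[int]_k := [set nu | forall i, 0 <= nu 0 i].

Definition star (k : nat) (E : set 'rV[int]_k) : set 'rV[int]_k :=
  [set e - nu | e in E & nu in @Nvec k].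

Definition orthant (k : nat) (t : 'rV[int]_k) : set 'rV[int]_k :=
  [set t + nu | nu in @Nvec k].

Lemma orthant_up (k : nat) (n : 'I_k -> nat) (t : 'rV[int]_k) v g :
  orthant t g -> orthant t (multideg n v + g).
Proof.
case=> nu nu0 <-; exists (multideg n v + nu); last by rewrite addrCA.
by move=> i; rewrite !mxE addr_ge0.
Qed.

Definition total_degree (k : nat) (t : 'rV[int]_k) : int := \sum_(i < k) t 0 i.

Lemma total_degree_is_additive k : zmod_morphism (@total_degree k).
Proof.
by move=> x y; rewrite -sumrB; apply: eq_bigr => i _; rewrite !mxE.
Qed.

HB.instance Definition _ k := GRing.isZmodMorphism.Build _ _ (@total_degree k)
  (@total_degree_is_additive k).

Lemma total_multideg (k : nat) (n : 'I_k -> nat) v :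
  total_degree (multideg n v) = 1.
Proof.
rewrite /total_degree (bigD1 (tagnat.sig1 v))//= big1 => [|i ne].
  by rewrite mxE !eqxx addr0.
by rewrite mxE (negbTE ne) andbF.
Qed.

Section StandardModules.
Context (S : comNzRingType) (k : nat) (n : 'I_k -> nat).
Context (M : gradedModule S (multideg n)).

Definition truncation (t : 'rV[int]_k) : gradedModule S (multideg n) :=
  restr M (@orthant_up k n t).

Definition total_grading : gradedModule S (fun _ : 'I_(\sum_(i < k) n i) => 1 : int) :=
  coarsen (@total_multideg k n) M.

End StandardModules.

(* Main.v *)
Require Import Defs.
From HB Require Import structures.
From mathcomp Require Import all_boot all_order all_algebra.
From mathcomp Require Import boolp classical_sets finset.
From mathcomp Require Import mpoly ring zify.
Import Defs.

(** Write N for the truncation of M and X for all the variables.  The Cech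
    complex of the generators of B tensored with the Koszul complex of one block
    of variables shows that this Koszul complex, on M, is exact in every
    multidegree in which only degrees >= mu occur.  The Koszul complex of N in
    multidegree g is the subcomplex of that of M where the j-th block contributes
    at most g_j - t_j variables.  Adding the blocks one at a time (with the new
    block left untruncated the complex is exact, and its quotient by the truncated
    complex is exact in low degrees by induction) one finds that its homology sits
    in the single degree |g| - |t|: N has linear Koszul homology.

    Every Cech cohomology class of N with respect to generators of m is killed by
    a power of m, so a nonzero one in a degree p + d > |t| would produce, after
    multiplication by a monomial, one killed by m, i.e. a top Koszul cycle; the
    Cech-Koszul double complex transgresses it to the Koszul homology of N in a
    forbidden degree.  Hence reg N <= |t|.  If the inequality were strict, the
    same double complex would give N = m N, whereas N is nonzero and bounded
    below. *)

Set Implicit Arguments.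
Unset Strict Implicit.
Unset Printing Implicit Defensive.

Import Order.TTheory GRing.Theory Num.Theory.
Local Open Scope ring_scope.

(** * Signs and Koszul complexes *)

(** Off the diagonal the terms cancel in pairs. The diagonal needs its own hypothesis, since
    [F i i = - F i i] does not force zero when 2 is not invertible. This serves for the squares of
    both the Koszul and the Cech differential. *)
Lemma sum_antisym (V : zmodType) (n : nat) (P : pred 'I_n) (F : 'I_n -> 'I_n -> V) :
  (forall i, P i -> F i i = 0) ->
  (forall i j, P i -> P j -> i != j -> F i j = - F j i) ->
  \sum_(i | P i) \sum_(j | P j) F i j = 0.
Proof.
move=> F0 FN.
have split_lt i : P i -> \sum_(j | P j) F i j =
    \sum_(j | P j && (i < j)%N) F i j + \sum_(j | P j && (j < i)%N) F i j.
  move=> Pi; rewrite (bigID (fun j : 'I_n => (i < j)%N)) /=; congr (_ + _).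
  rewrite (bigID (fun j : 'I_n => (j < i)%N)) /= [X in _ + X]big1 ?addr0.
    by apply: eq_bigl => j; case: (P j) => //=; case: ltngtP.
  move=> j /andP[/andP[Pj ij] ji]; rewrite (_ : j = i) ?F0//.
  by apply: val_inj => /=; lia.
rewrite (eq_bigr _ split_lt) big_split /=.
rewrite [X in _ + X](exchange_big_dep P) /= => [|i j _ /andP[]//].
apply/eqP; rewrite addr_eq0 -sumrN; apply/eqP/eq_bigr => i Pi.
rewrite -sumrN; apply: eq_big => [j|j /andP[Pj ij]]; first by rewrite Pi.
by rewrite FN//; apply: contraTneq ij => ->; rewrite ltnn.
Qed.

Section Sign.
Context (A : comNzRingType) (n : nat).
Implicit Types (J K : {set 'I_n}) (u v : 'I_n).

Definition sgn J v : A := (-1) ^+ #|[set i in J | (i < v)%N]|.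

Lemma sgnU J u v : u \notin J -> sgn (u |: J) v = (-1) ^+ (u < v)%N * sgn J v.
Proof.
move=> uJ; rewrite /sgn -exprD; congr (_ ^+ _).
case: (boolP (u < v)%N) => uv /=.
  rewrite (_ : [set i in u |: J | (i < v)%N] = u |: [set i in J | (i < v)%N]).
    by rewrite cardsU1 inE (negbTE uJ).
  by apply/setP=> i; rewrite !inE; case: eqP => [->|].
rewrite add0n; congr #|pred_of_set _|; apply/setP=> i; rewrite !inE.
by case: eqP => [->|]//=; rewrite (negbTE uJ) (negbTE uv).
Qed.

Lemma sgnD J u v : u \in J -> sgn J v = (-1) ^+ (u < v)%N * sgn (J :\ u) v.
Proof. by move=> uJ; rewrite -{1}(setD1K uJ) sgnU// !inE eqxx. Qed.

Lemma sgnD1 J v : sgn (J :\ v) v = sgn J v.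
Proof.
congr (_ ^+ #|pred_of_set _|); apply/setP=> i; rewrite !inE.
by case: eqP => [->|]//=; rewrite ltnn andbF.
Qed.

Lemma sgnU1 J v : sgn (v |: J) v = sgn J v.
Proof.
congr (_ ^+ #|pred_of_set _|); apply/setP=> i; rewrite !inE.
by case: eqP => [->|]//=; rewrite ltnn andbF.
Qed.

Lemma sgn_sqr J v : sgn J v * sgn J v = 1.
Proof. by rewrite /sgn -expr2 sqrr_sign. Qed.

Lemma sign_lt_anti u v : u != v ->
  (-1) ^+ (u < v)%N = - (-1) ^+ (v < u)%N :> A.
Proof. by case: ltngtP => [||/val_inj->]; rewrite ?eqxx ?expr0 ?expr1 ?opprK. Qed.

End Sign.

(* A Koszul chain is a family indexed by the sets of variables, all homological
   degrees being bundled together; koszul_d P is the differential of the variables in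
   P, the other ones being inert. *)
Section Koszul.
Context (A : comNzRingType) (V : lmodType A) (n : nat) (x : 'I_n -> A).
Notation chain := {ffun {set 'I_n} -> V}.
Implicit Types (z : chain) (K : {set 'I_n}) (P : {set 'I_n}).

Definition koszul_d1 v z : chain :=
  [ffun K : {set 'I_n} =>
    if v \in K then 0 else (sgn A K v * x v) *: z (v |: K)].

(** Exterior multiplication by the basis vector of [v], where [koszul_d1 v] is the contraction
    against it, scaled by [x v]. *)
Definition koszul_e1 v z : chain :=
  [ffun K : {set 'I_n} => if v \in K then sgn A K v *: z (K :\ v) else 0].

Lemma koszul_d1_linear v : linear (koszul_d1 v).
Proof.
move=> a y z; apply/ffunP=> K; rewrite !ffunE; case: ifP => _.
  by rewrite scaler0 addr0.
by rewrite scalerDr !scalerA; congr (_ *: _ + _); ring.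
Qed.
HB.instance Definition _ v :=
  GRing.isLinear.Build A chain chain *:%R (koszul_d1 v) (koszul_d1_linear v).

Lemma koszul_e1_linear v : linear (koszul_e1 v).
Proof.
move=> a y z; apply/ffunP=> K; rewrite !ffunE; case: ifP => _.
  by rewrite scalerDr !scalerA; congr (_ *: _ + _); ring.
by rewrite scaler0 addr0.
Qed.
HB.instance Definition _ v :=
  GRing.isLinear.Build A chain chain *:%R (koszul_e1 v) (koszul_e1_linear v).

Definition koszul_d P z : chain := \sum_(v in P) koszul_d1 v z.

Lemma koszul_d_linear P : linear (koszul_d P).
Proof.
move=> a y z; rewrite /koszul_d scaler_sumr -big_split /=.
by apply: eq_bigr => v _; rewrite linearP.
Qed.
HB.instance Definition _ P :=
  GRing.isLinear.Build A chain chain *:%R (koszul_d P) (koszul_d_linear P).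

Lemma kdE P z K :
  koszul_d P z K = \sum_(v in P | v \notin K) (sgn A K v * x v) *: z (v |: K).
Proof.
rewrite /koszul_d sum_ffunE big_mkcondr /=; apply: eq_bigr => v _.
by rewrite ffunE; case: ifP.
Qed.

Lemma koszul_d1_sqr v z : koszul_d1 v (koszul_d1 v z) = 0.
Proof.
by apply/ffunP=> K; rewrite !ffunE; case: ifP => // _; rewrite setU11 scaler0.
Qed.

Lemma koszul_d1_anti u v z : u != v -> koszul_d1 u (koszul_d1 v z) = - koszul_d1 v (koszul_d1 u z).
Proof.
move=> uv; apply/ffunP=> K; rewrite !ffunE !inE (negbTE uv) eq_sym (negbTE uv) /=.
case: (boolP (u \in K)) => uK; case: (boolP (v \in K)) => vK;
  rewrite ?scaler0 ?oppr0//.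
rewrite !scalerA !(sgnU A _) // setUCA (sign_lt_anti A uv) -scaleNr.
by congr (_ *: _); ring.
Qed.

Lemma koszul_d_koszul_d P z : koszul_d P (koszul_d P z) = 0.
Proof.
rewrite {1}/koszul_d.
under eq_bigr => u _ do rewrite /koszul_d linear_sum /=.
apply: sum_antisym => [v _|u v _ _]; [exact: koszul_d1_sqr|exact: koszul_d1_anti].
Qed.

Lemma koszul_d1_e1 v z : koszul_d1 v (koszul_e1 v z) + koszul_e1 v (koszul_d1 v z) = x v *: z.
Proof.
apply/ffunP=> K; rewrite !ffunE !inE !eqxx /=.
case: (boolP (v \in K)) => vK.
  rewrite add0r scalerA setD1K// sgnD1.
  by congr (_ *: _); rewrite mulrA sgn_sqr mul1r.
rewrite addr0 scalerA setU1K// sgnU1.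
by congr (_ *: _); rewrite mulrAC sgn_sqr mul1r.
Qed.

Lemma koszul_d1_e1_anti u v z : u != v ->
  koszul_d1 u (koszul_e1 v z) + koszul_e1 v (koszul_d1 u z) = 0.
Proof.
move=> uv; apply/ffunP=> K; rewrite !ffunE !inE (negbTE uv) (eq_sym v) (negbTE uv) /=.
case: (boolP (u \in K)) => uK; case: (boolP (v \in K)) => vK;
  rewrite ?scaler0 ?addr0 ?add0r//.
rewrite !scalerA (sgnU A _ uK) (sgnD A u vK) (sign_lt_anti A uv).
have -> : u |: K :\ v = (u |: K) :\ v.
  by apply/setP=> i; rewrite !inE; case: (eqVneq i u) => //= ->; rewrite uv.
rewrite -scalerDl (_ : _ + _ = 0) ?scale0r//.
have s2 : (-1) ^+ (v < u)%N * (-1) ^+ (v < u)%N = 1 :> A.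
  by rewrite -expr2 sqrr_sign.
transitivity ((1 - (-1) ^+ (v < u)%N * (-1) ^+ (v < u)%N) *
    (sgn A (K :\ v) u * x u * sgn A K v)); first by ring.
by rewrite s2 subrr mul0r.
Qed.

(** The anticommutator of [koszul_d1 u] and [koszul_e1 v] is [x v] if [u = v] and 0 otherwise. Hence
    elements of the ideal of the [x v], [v] in [P], act by zero on Koszul homology. *)
Lemma koszul_homotopy P (a : 'I_n -> A) z :
  koszul_d P (\sum_(v in P) a v *: koszul_e1 v z) + \sum_(v in P) a v *: koszul_e1 v (koszul_d P z)
  = (\sum_(v in P) a v * x v) *: z.
Proof.
rewrite linear_sum -big_split scaler_suml /=; apply: eq_bigr => v vP.
rewrite linearZ /= -scalerDr -scalerA; congr (_ *: _).
rewrite /koszul_d linear_sum -big_split (bigD1 v)//= koszul_d1_e1 big1 ?addr0//.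
by move=> u /andP[_ uv]; exact: koszul_d1_e1_anti.
Qed.

End Koszul.


(** * Double complexes *)

(* The differential d lowers q and delta raises p; the (p, q) piece A p q is
   given by a projection pi p q of an ambient group, so that any preimage of a
   homogeneous element can be made homogeneous. *)
Section DoubleComplex.
Context (U : zmodType) (d delta : {additive U -> U}) (pi : nat -> nat -> U -> U).
Hypothesis dd : forall x, d (d x) = 0.
Hypothesis deltadelta : forall x, delta (delta x) = 0.
Hypothesis d_delta : forall x, d (delta x) = delta (d x).
Hypothesis pi_idem : forall p q x, pi p q (pi p q x) = pi p q x.
Hypothesis pi_sub : forall p q, {morph pi p q : x y / x - y}.
Hypothesis pi_d : forall p q x, pi p q (d x) = d (pi p q.+1 x).
Hypothesis pi_delta : forall p q x, pi p.+1 q (delta x) = delta (pi p q x).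
Hypothesis pi_delta0 : forall q x, pi 0%N q (delta x) = 0.

Let A p q x := pi p q x = x.

Let pi_delta_im p q x : exists y, pi p q (delta x) = delta y.
Proof.
by case: p => [|p]; [exists 0; rewrite raddf0|exists (pi p q x)].
Qed.

Let pi_add p q : {morph pi p q : x y / x + y}.
Proof.
move=> x y; rewrite -{1}[y]opprK pi_sub -[- y]sub0r pi_sub.
have -> : pi p q 0 = 0 by rewrite -{1}(subrr 0) pi_sub subrr.
by rewrite sub0r opprK.
Qed.

(** A staircase: [delta x] is a [d]-cycle in column 1, hence a [d]-boundary, and so on to the right
    until the columns vanish. Row exactness at the places [(p, i + p)] then carries the correction
    back to column 0, where a [delta]-image is zero. *)
Lemma columns_exact_of_rows (r i : nat) :
  (forall p q x, A p q x -> (r < p)%N -> x = 0) ->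
  (forall p q x, A p.+1 q x -> d x = 0 -> exists y, x = d y) ->
  (forall p x, A p (i + p)%N x -> delta x = 0 -> exists y, x = delta y) ->
  forall x, A 0 i x -> d x = 0 -> exists y, x = d y.
Proof.
move=> bound cols rows.
have colsA p q x : A p.+1 q x -> d x = 0 -> exists2 y, A p.+1 q.+1 y & x = d y.
  move=> Ax /(cols _ _ _ Ax)[y xE]; exists (pi p.+1 q.+1 y); first exact: pi_idem.
  by rewrite -pi_d -xE Ax.
have rowsA p x : A p.+1 (i + p.+1)%N x -> delta x = 0 ->
    exists2 y, A p (i + p.+1)%N y & x = delta y.
  move=> Ax /(rows _ _ Ax)[y xE]; exists (pi p (i + p.+1)%N y); first exact: pi_idem.
  by rewrite -pi_delta -xE Ax.
have dA p q x : A p q.+1 x -> A p q (d x) by rewrite /A pi_d => ->.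
have deltaA p q x : A p q x -> A p.+1 q (delta x) by rewrite /A pi_delta => ->.
have AB p q x y : A p q x -> A p q y -> A p q (x - y).
  by rewrite /A pi_sub => -> ->.
(* Induction on the number [m] of columns left before the bound [r], beyond which [x] is zero. *)
have main m : forall p x, (r < p.+1 + m)%N -> A p.+1 (i + p.+1)%N x ->
    d (delta x) = 0 ->
    exists v u, A p (i + p.+1)%N u /\ x = d v + delta u.
  elim: m => [|m IH] p x rp Ax dx0.
    exists 0, 0; split; last by rewrite !raddf0 addr0 (bound _ _ _ Ax)//; lia.
    by rewrite /A -{1}(subrr 0) pi_sub subrr.
  have [y Ay xE] := colsA _ _ _ (deltaA _ _ _ Ax) dx0.
  rewrite -addnS in Ay.
  have [||v [u [Au yE]]] := IH p.+1 y _ Ay; first by lia.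
    by rewrite d_delta -xE deltadelta.
  rewrite addnS in Au.
  have [||u' Au' xE'] := rowsA p (x - d u); first by apply: AB (dA _ _ _ Au).
    by rewrite raddfB -d_delta xE yE raddfD /= dd add0r subrr.
  by exists u, u'; split=> //; rewrite -xE' addrC subrK.
move=> x Ax dx0.
have [|y Ay xE] := colsA 0 _ _ (deltaA _ _ _ Ax); first by rewrite d_delta dx0 raddf0.
rewrite -[i.+1]addn1 in Ay.
have [||v [u [Au yE]]] := main r 0%N y _ Ay; first by lia.
  by rewrite d_delta -xE deltadelta.
rewrite addn1 in Au; exists u; apply/eqP; rewrite -subr_eq0; apply/eqP.
have AxB : A 0 i (x - d u) := AB _ _ _ _ Ax (dA _ _ _ Au).
have [||u' xE'] := rows 0%N (x - d u); first by rewrite addn0.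
  by rewrite raddfB -d_delta xE yE raddfD /= dd add0r subrr.
by rewrite -AxB xE' pi_delta0.
Qed.

(** A zigzag along the diagonal through [(p0, q0)]: the relation [d x = delta y] passes to [y] one
    column to the left, down to column 0, where [delta]-images project to zero and [x] becomes a
    [d]-cycle. *)
Lemma socle_transgression (p0 q0 : nat) :
  (forall p q x, A p.+1 q x -> d x = 0 -> exists y, x = d y) ->
  (forall q x, (q + p0 = q0)%N -> A 0 q x -> d x = 0 -> exists y, x = d y) ->
  (forall p x, A p 0 x -> d x = 0) ->
  (forall p q x, (p < p0)%N -> (p + q0 = q + p0 + 1)%N -> A p q x ->
     delta x = 0 -> exists y, x = delta y) ->
  forall x, A p0 q0 x -> (exists y, d x = delta y) ->
  exists v u, x = d v + delta u.
Proof.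
move=> cols col0 d0 rows.
have cols' p q x : (p + q0 = q + p0)%N -> A p q x -> d x = 0 -> exists y, x = d y.
  by case: p => [|p] pq; [apply: col0; lia|exact: cols].
suff main p : forall q x, (p <= p0)%N -> (p + q0 = q + p0)%N -> A p q x ->
    (exists y, d x = delta y) -> exists v u, x = d v + delta u.
  by move=> x; apply: main; lia.
elim: p => [|p IH] [|q] x pp0 pq Ax [y dxE].
- have [|v ->] := cols' _ _ _ pq Ax; first exact: d0 Ax.
  by exists v, 0; rewrite raddf0 addr0.
- have [|v ->] := cols' _ _ _ pq Ax; last by exists v, 0; rewrite raddf0 addr0.
  by rewrite -Ax -pi_d dxE pi_delta0.
- have [|v ->] := cols' _ _ _ pq Ax; first exact: d0 Ax.
  by exists v, 0; rewrite raddf0 addr0.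
have dxE' : d x = delta (pi p q y) by rewrite -pi_delta -dxE pi_d Ax.
have Ay : A p q (pi p q y) by rewrite /A pi_idem.
have [||v [u yE]] := IH q (pi p q y) (ltnW pp0) _ Ay; first by lia.
  move: q pq Ax {IH dxE} dxE' Ay => [|q] pq Ax dxE' Ay.
    by exists 0; rewrite raddf0 (d0 _ _ Ay).
  (* The element [d y] is a [delta]-cycle one place below the diagonal, which is where [rows]
     applies. *)
  have [||||z ->] := rows p q (d (pi p q.+1 y)); first by [].
  - by lia.
  - by rewrite /A pi_d pi_idem.
  - by rewrite -d_delta -dxE' dd.
  by exists z.
have [y' piu] := pi_delta_im p q u.
have dyE : delta (pi p q y) = d (delta (pi p q.+1 v)).
  by rewrite -pi_idem yE pi_add pi_d piu raddfD /= deltadelta addr0 d_delta.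
have [||v' xE] := cols' _ _ (x - delta (pi p q.+1 v)) pq.
- by rewrite /A pi_sub Ax pi_delta pi_idem.
- by rewrite raddfB /= dxE' dyE subrr.
by exists v', (pi p q.+1 v); rewrite -xE subrK.
Qed.
End DoubleComplex.


(** * Localizations and Cech complexes *)

Section LocTheory.
Context (A : comNzRingType) (M : lmodType A).
Implicit Types g h : A.

Lemma fracZ g a (m : M) e : a *: frac g m e = frac g (a *: m) e.
Proof. exact: loc_scaleE. Qed.

Lemma frac_add g (m m' : M) e : frac g (m + m') e = frac g m e + frac g m' e.
Proof. by rewrite fracD -scalerDr frac_factor. Qed.

Lemma frac_eq0 g (m : M) e : frac g m e = 0 <-> exists N, g ^+ N *: m = 0.
Proof.
rewrite -[X in _ = X <-> _](@frac0 A M g 0%N); split=> [/fracP[N]|[N h]].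
  by rewrite scaler0 addn0 => h; exists N.
by apply/fracP; exists N; rewrite addn0 h scaler0.
Qed.

Lemma loc_map_linear g g' h : g' = h * g -> linear (@loc_map A M g g' h).
Proof.
move=> gE a x y; elim/(@frac_ind A M g): x => m e; elim/(@frac_ind A M g): y => m' e'.
rewrite fracZ fracD !(loc_mapE _ _ gE) fracZ fracD; congr frac.
rewrite scalerDr !scalerA gE !exprMn !exprD.
by congr (_ *: _ + _ *: _); ring.
Qed.

Lemma loc_map0 g g' h : g' = h * g -> @loc_map A M g g' h 0 = 0.
Proof.
move=> gE; have := loc_map_linear gE 1 0 0.
by rewrite !scale1r addr0 => /eqP; rewrite -subr_eq0 opprD addNKr oppr_eq0 => /eqP.
Qed.

Lemma loc_mapZ g g' h a (x : loc M g) : g' = h * g ->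
  loc_map g' h (a *: x) = a *: loc_map g' h x.
Proof.
by move=> gE; have := loc_map_linear gE a x 0; rewrite (loc_map0 gE) !addr0.
Qed.

Lemma loc_map_sum g g' h (I : Type) (s : seq I) (P : pred I) (F : I -> loc M g) :
  g' = h * g ->
  loc_map g' h (\sum_(i <- s | P i) F i) = \sum_(i <- s | P i) loc_map g' h (F i).
Proof.
move=> gE; elim/big_rec2: _ => [|i x y _ <-]; first exact: loc_map0.
by have := loc_map_linear gE 1 (F i) y; rewrite !scale1r.
Qed.

Lemma loc_map_ker g g' h (x : loc M g) : g' = h * g ->
  loc_map g' h x = 0 -> exists L, h ^+ L *: x = 0.
Proof.
move=> gE; elim/(@frac_ind A M g): x => m e; rewrite (loc_mapE _ _ gE).
case/frac_eq0=> N; rewrite gE scalerA => h0; exists (N + e)%N.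
rewrite fracZ; apply/frac_eq0; exists N; rewrite scalerA -[RHS]h0.
by congr (_ *: _); rewrite exprMn exprD; ring.
Qed.

Lemma loc_map_coker g g' h (y : loc M g') : g' = h * g ->
  exists L, exists x : loc M g, loc_map g' h x = h ^+ L *: y.
Proof.
move=> gE; elim/(@frac_ind A M g'): y => m e; exists e, (frac g m e).
by rewrite (loc_mapE _ _ gE) fracZ.
Qed.

Lemma loc_mapC g g1 g2 g12 h1 h2 (x : loc M g) :
  g1 = h1 * g -> g2 = h2 * g -> g12 = h2 * g1 ->
  loc_map g12 h2 (loc_map g1 h1 x) = loc_map g12 h1 (loc_map g2 h2 x).
Proof.
move=> e1 e2 e12; have e21 : g12 = h1 * g2 by rewrite e12 e1 e2; ring.
elim/(@frac_ind A M g): x => m e; rewrite !(loc_mapE _ _ e1, loc_mapE _ _ e2).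
rewrite (loc_mapE _ _ e12) (loc_mapE _ _ e21) !scalerA.
by congr (frac _ (_ *: _) _); ring.
Qed.

(** With [loc_scale_inj]: a divisor of [g] acts bijectively on the localization at [g], so the
    Koszul homotopy can be inverted there. *)
Lemma loc_div g h h' (x : loc M g) : g = h * h' -> exists y, h *: y = x.
Proof.
move=> gE; elim/(@frac_ind A M g): x => m e; exists (frac g (h' *: m) e.+1).
by rewrite fracZ scalerA -gE -[g in g *: m]expr1 -add1n frac_factor.
Qed.

Lemma loc_scale_inj g h h' (x : loc M g) : g = h * h' -> h *: x = 0 -> x = 0.
Proof.
move=> gE; elim/(@frac_ind A M g): x => m e; rewrite fracZ => /frac_eq0[N].
rewrite scalerA => h0; apply/frac_eq0; exists N.+1.
have -> : g ^+ N.+1 = h' * (g ^+ N * h) by rewrite exprSr [X in _ * X]gE; ring.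
by rewrite -scalerA h0 scaler0.
Qed.

End LocTheory.

Section CechTheory.
Context (A : comNzRingType) (M : lmodType A) (r : nat) (f : 'I_r -> A).
Notation cochain := (cochain M f).
Implicit Types (J : {set 'I_r}) (c : cochain).

HB.instance Definition _ := gen_eqMixin cochain.
HB.instance Definition _ := gen_choiceMixin cochain.

Let cochain_addA : associative (fun c c' : cochain => (fun J => c J + c' J) : cochain).
Proof. by move=> x y z; apply: functional_extensionality_dep => J; rewrite addrA. Qed.
Let cochain_addC : commutative (fun c c' : cochain => (fun J => c J + c' J) : cochain).
Proof. by move=> x y; apply: functional_extensionality_dep => J; rewrite addrC. Qed.
Let cochain_add0 : left_id ((fun J => 0) : cochain)
  (fun c c' : cochain => (fun J => c J + c' J) : cochain).
Proof. by move=> x; apply: functional_extensionality_dep => J; rewrite add0r. Qed.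
Let cochain_addN : left_inverse ((fun J => 0) : cochain)
  (fun c : cochain => (fun J => - c J) : cochain)
  (fun c c' : cochain => (fun J => c J + c' J) : cochain).
Proof. by move=> x; apply: functional_extensionality_dep => J; rewrite addNr. Qed.
HB.instance Definition _ := GRing.isZmodule.Build cochain
  cochain_addA cochain_addC cochain_add0 cochain_addN.

Let cochain_scale (a : A) (c : cochain) : cochain := fun J => a *: c J.
Let cochain_scaleA a b c : cochain_scale a (cochain_scale b c) = cochain_scale (a * b) c.
Proof. by apply: functional_extensionality_dep => J; rewrite /cochain_scale scalerA. Qed.
Let cochain_scale1 : left_id 1 cochain_scale.
Proof. by move=> c; apply: functional_extensionality_dep => J; rewrite /cochain_scale scale1r. Qed.
Let cochain_scaleDr : right_distributive cochain_scale +%R.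
Proof. by move=> a c c'; apply: functional_extensionality_dep => J; exact: scalerDr. Qed.
Let cochain_scaleDl c : {morph cochain_scale^~ c : a b / a + b}.
Proof. by move=> a b; apply: functional_extensionality_dep => J; exact: scalerDl. Qed.
HB.instance Definition _ := GRing.Zmodule_isLmodule.Build A cochain
  cochain_scaleA cochain_scale1 cochain_scaleDr cochain_scaleDl.

Lemma cochainP c c' : (forall J, c J = c' J) -> c = c'.
Proof. exact: functional_extensionality_dep. Qed.

Lemma cochainD c c' J : (c + c') J = c J + c' J. Proof. by []. Qed.
Lemma cochainN c J : (- c) J = - c J. Proof. by []. Qed.
Lemma cochain0 J : (0 : cochain) J = 0. Proof. by []. Qed.
Lemma cochainZ a c J : (a *: c) J = a *: c J. Proof. by []. Qed.
Lemma cochain_sum (I : Type) (s : seq I) (P : pred I) (F : I -> cochain) J :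
  (\sum_(i <- s | P i) F i) J = \sum_(i <- s | P i) F i J.
Proof. by elim/big_rec2: _ => // i _ c _ <-. Qed.

Lemma cech_dE c J : cech_d c J =
  \sum_(j in J) sgn A J j *: loc_map (subprod f J) (f j) (c (J :\ j)).
Proof. by []. Qed.

Lemma cech_d_linear : linear (@cech_d A M r f).
Proof.
move=> a c c'; apply: cochainP => J.
rewrite cochainD cochainZ !cech_dE scaler_sumr -big_split /=.
apply: eq_bigr => j jJ; rewrite cochainD cochainZ.
rewrite (loc_map_linear (subprodD1 f jJ)) scalerDr !scalerA.
by congr (_ *: _ + _); ring.
Qed.
HB.instance Definition _ :=
  GRing.isLinear.Build A cochain cochain *:%R (@cech_d A M r f) cech_d_linear.

Lemma cech_dZ a c : cech_d (a *: c) = a *: cech_d c.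
Proof. exact: linearZ. Qed.

Lemma cech_d_cech_d c : cech_d (cech_d c) = 0.
Proof.
apply: cochainP => J; rewrite cochain0 cech_dE.
(* Extension by zero to the diagonal makes the double sum run over all pairs in [J], as
   [sum_antisym] requires. *)
pose F i j := if j \in J :\ i then (sgn A J i * sgn A (J :\ i) j) *:
  loc_map (subprod f J) (f i) (loc_map (subprod f (J :\ i)) (f j) (c (J :\ i :\ j)))
  else 0.
transitivity (\sum_(i in J) \sum_(j in J) F i j).
  apply: eq_bigr => i iJ; rewrite cech_dE.
  rewrite (loc_map_sum _ _ _ (subprodD1 f iJ)) scaler_sumr.
  rewrite big_mkcond [RHS]big_mkcond /=; apply: eq_bigr => j _.
  rewrite /F; case: (boolP (j \in J :\ i)) => [|_]; last by rewrite if_same.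
  rewrite inE => /andP[_ ->]; rewrite -scalerA; congr (_ *: _).
  exact: loc_mapZ (subprodD1 f iJ).
apply: sum_antisym => [i _|i j iJ jJ ij]; first by rewrite /F !inE eqxx.
rewrite /F !inE iJ jJ ij eq_sym ij /=.
have jJi : j \in J :\ i by rewrite !inE eq_sym ij.
have iJj : i \in J :\ j by rewrite !inE ij.
have Jij : J :\ i :\ j = J :\ j :\ i by rewrite !setDDl setUC.
rewrite -(loc_mapC (g1 := subprod f (J :\ j)) (h1 := f i) (g := subprod f (J :\ i :\ j)));
  last first.
- exact: subprodD1.
- exact: subprodD1.
- by rewrite Jij; exact: subprodD1.
rewrite Jij -scaleNr; congr (_ *: _).
rewrite (sgnD A j iJ) [sgn A J i](sgnD A i jJ) (sign_lt_anti A ij); ring.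
Qed.

End CechTheory.


(** * Torsion of Cech cohomology, and the augmentation from the module *)

Section CechTorsion.
Context (A : comNzRingType) (M : lmodType A) (r : nat) (f : 'I_r -> A).
Notation cochain := (cochain M f).
Implicit Types (J : {set 'I_r}) (c : cochain).

(* Up to a power of f i, the components c (i |: J) lift to the localization at
   J; this defines a contraction b, exact at the sets containing i and hence,
   after a further power of f i, everywhere. *)
Lemma cech_generator_torsion c i : cech_d c = 0 ->
  exists L, exists b, f i ^+ L *: c = cech_d b.
Proof.
move=> c0.
have /(_ _)/cid lift' J : exists Lx : nat * loc M (subprod f J), i \notin J ->
    loc_map (subprod f (i |: J)) (f i) Lx.2 = f i ^+ Lx.1 *: c (i |: J).
  case: (boolP (i \in J)) => iJ; first by exists (0%N, 0).
  have /(loc_map_coker (c (i |: J)))[L [x xE]] :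
      subprod f (i |: J) = f i * subprod f J.
    by rewrite (subprodD1 f (setU11 i J)) setU1K.
  by exists (L, x).
have [Lf [xf lift]] : exists (Lf : {set 'I_r} -> nat) (xf : forall J, loc M (subprod f J)),
    forall J, i \notin J ->
    loc_map (subprod f (i |: J)) (f i) (xf J) = f i ^+ Lf J *: c (i |: J).
  exists (fun J => (sval (lift' J)).1), (fun J => (sval (lift' J)).2) => J.
  exact: svalP (lift' J).
pose L0 := \max_J Lf J.
pose b : cochain := fun J => if i \in J then 0 else
  sgn A J i *: (f i ^+ (L0 - Lf J) *: xf J).
pose e := cech_d b - f i ^+ L0 *: c.
have bE J : i \in J -> cech_d b J = f i ^+ L0 *: c J.
  move=> iJ; rewrite cech_dE (big_setD1 i)//= [X in _ + X]big1 => [|j]; last first.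
    rewrite !inE => /andP[ji jJ]; rewrite /b !inE eq_sym ji iJ /=.
    by rewrite (loc_map0 _ (subprodD1 f jJ)) scaler0.
  rewrite addr0 /b !inE eqxx /= !(loc_mapZ _ _ (subprodD1 f iJ)).
  have := lift (J :\ i); rewrite !inE eqxx => /(_ isT).
  rewrite (setD1K iJ) => ->.
  rewrite !scalerA sgnD1; congr (_ *: _).
  rewrite (mulrA (sgn A J i) (sgn A J i)) sgn_sqr mul1r -exprD subnK//.
  exact: (leq_bigmax (F := Lf)).
have e_van J : i \in J -> e J = 0.
  by move=> iJ; rewrite /e cochainD cochainN cochainZ bE// subrr.
have de : cech_d e = 0 by rewrite /e raddfB /= cech_dZ cech_d_cech_d c0 scaler0 subrr.
(* Since [e] vanishes on the sets containing [i], the component of [cech_d e = 0] at [i |: J] has a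
   single term, the image of [e J]; so a power of [f i] kills [e J]. *)
have /(_ _)/cid kill J : exists L, f i ^+ L *: e J = 0.
  case: (boolP (i \in J)) => iJ; first by exists 0%N; rewrite e_van// scaler0.
  have iUJ := setU11 i J.
  have gE : subprod f (i |: J) = f i * subprod f J.
    by rewrite (subprodD1 f iUJ) setU1K.
  apply: (loc_map_ker gE).
  have := congr1 (fun c : cochain => c (i |: J)) de; rewrite cochain0 cech_dE.
  rewrite (big_setD1 i iUJ) /= [X in _ + X]big1 => [|j]; last first.
    rewrite !inE => /andP[ji jJ]; rewrite e_van; last by rewrite !inE eqxx eq_sym ji.
    by rewrite (loc_map0 _ (subprodD1 f _)) ?scaler0// !inE jJ.
  rewrite addr0 (setU1K iJ) => /(congr1 (fun x => sgn A (i |: J) i *: x)).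
  by rewrite scalerA sgn_sqr scale1r scaler0.
pose L1 := \max_J (sval (kill J)).
exists (L1 + L0)%N, (f i ^+ L1 *: b); rewrite cech_dZ.
apply/eqP; rewrite eq_sym -subr_eq0 exprD -scalerA -scalerBr; apply/eqP.
apply: cochainP => J; rewrite cochain0 cochainZ -/e.
rewrite -(@subnK (sval (kill J)) L1) ?exprD -?scalerA ?(svalP (kill J)) ?scaler0//.
exact: (leq_bigmax (F := fun J => sval (kill J))).
Qed.

(** The multipliers sending [c] to a coboundary form an ideal. It contains a power of each [f i],
    hence a power of any combination: each term of the expansion of [(x + y) ^+ (m + n)] is
    divisible by [x ^+ m] or by [y ^+ n]. *)
Lemma cech_torsion c (a : 'I_r -> A) : cech_d c = 0 ->
  exists L, exists b, (\sum_i a i * f i) ^+ L *: c = cech_d b.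
Proof.
move=> c0; pose T p := exists b : cochain, p *: c = cech_d b.
have TM p q : T q -> T (p * q).
  by case=> b bE; exists (p *: b); rewrite -scalerA bE cech_dZ.
have TD p q : T p -> T q -> T (p + q).
  by move=> [b bE] [b' bE']; exists (b + b'); rewrite scalerDl bE bE' raddfD.
suff [L [b bE]] : exists L, T ((\sum_i a i * f i) ^+ L) by exists L, b.
elim/big_ind: _ => [|x y [m Tx] [n Ty]|i _].
- by exists 1%N, 0; rewrite expr1 scale0r raddf0.
- exists (m + n)%N; rewrite exprDn; elim/big_ind: _ => //= [|j _].
    by exists 0; rewrite scale0r raddf0.
  rewrite -mulr_natl; apply: (TM); case: (leqP n j) => nj.
    by rewrite -(subnK nj) exprD mulrA; apply: TM.
  have mj : (m <= m + n - j)%N by lia.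
  by rewrite -(subnK mj) exprD mulrAC; apply: TM.
have [L [b bE]] := cech_generator_torsion i c0.
by exists L; rewrite exprMn; apply: TM; exists b.
Qed.

(** The isomorphism of [M] with the degree 0 term of the Cech complex, the localization at the empty
    product 1. It identifies column 0 of the double complex with the Koszul complex of [M]. *)
Definition cech_aug (m : M) : cochain :=
  fun J => if J == set0 then frac (subprod f J) m 0 else 0.

Lemma cech_aug_linear : linear cech_aug.
Proof.
move=> a x y; apply: cochainP => J; rewrite cochainD cochainZ /cech_aug.
case: ifP => _; last by rewrite scaler0 addr0.
by rewrite fracZ frac_add.
Qed.
HB.instance Definition _ :=
  GRing.isLinear.Build A M cochain *:%R cech_aug cech_aug_linear.

Lemma subprod0 : subprod f set0 = 1.
Proof. by rewrite /subprod big_set0. Qed.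

Lemma cech_aug_inj : injective cech_aug.
Proof.
move=> x y /(congr1 (fun c : cochain => c set0)); rewrite /cech_aug eqxx.
by case/fracP=> N; rewrite subprod0 !expr1n !scale1r.
Qed.

Lemma cech_aug_surj c : (forall J, J != set0 -> c J = 0) -> exists m, c = cech_aug m.
Proof.
move=> c0; have [m mE] : exists m, c set0 = frac (subprod f set0) m 0.
  elim/(@frac_ind A M (subprod f set0)): (c set0) => m e; exists m; apply/fracP.
  by exists 0%N; rewrite subprod0 !expr1n.
exists m; apply: cochainP => J; rewrite /cech_aug.
by case: (eqVneq J set0) => [->|]; [exact: mE|exact: c0].
Qed.

End CechTorsion.


(** * Homogeneous components *)

Lemma sum_seq_delta (G : eqType) (V : zmodType) (s : seq G) (g : G) (x : V) :
  uniq s -> \sum_(h <- s) (if h == g then x else 0) = if g \in s then x else 0.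
Proof.
move=> us; case: ifPn => gs.
  by rewrite (bigD1_seq g)//= eqxx big1 ?addr0// => h /negbTE->.
by rewrite big1_seq// => h /andP[_ hs]; case: eqP hs gs => // -> ->.
Qed.

Section Projection.
Context (G V : zmodType) (V_ : G -> set V) (dV : direct_decomposition V_).

Let decomp x : exists sf : seq G * (G -> V),
  [/\ uniq sf.1, forall g, g \in sf.1 -> V_ g (sf.2 g) & x = \sum_(g <- sf.1) sf.2 g].
Proof.
have [s [f [us fV ->]]] := hsum_uniq (dd0 dV) (ddB dV) (dd_sum dV x).
by exists (s, f); split=> // g /fV[].
Qed.

(** The decomposition of [x] is a choice; [proj_unique] shows that the component does not depend on
    it. *)
Definition proj g x : V :=
  let sf := sval (cid (decomp x)) in if g \in sf.1 then sf.2 g else 0.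

Lemma dd_opp g x : V_ g x -> V_ g (- x).
Proof. by move=> gx; rewrite -sub0r; apply: (ddB dV) => //; exact: (dd0 dV). Qed.

Lemma dd_add g x y : V_ g x -> V_ g y -> V_ g (x + y).
Proof. by move=> gx gy; rewrite -[y]opprK; apply: (ddB dV) => //; exact: dd_opp. Qed.

Lemma proj_hcomp g x : V_ g (proj g x).
Proof.
rewrite /proj; case: cid => -[s f] [/= _ fV _].
by case: ifP => [/fV//|_]; exact: (dd0 dV).
Qed.

(** Both decompositions are padded with zeros to a common support, where independence applies to
    their difference. *)
Lemma proj_unique s f x : uniq s -> (forall g, g \in s -> V_ g (f g)) ->
  x = \sum_(g <- s) f g -> forall g, proj g x = if g \in s then f g else 0.
Proof.
move=> us fV xE g; rewrite /proj; case: cid => -[s' f'] [/= us' fV' xE'].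
pose F h := (if h \in s' then f' h else 0) - (if h \in s then f h else 0).
pose S := undup (s ++ s').
have ext (l : seq G) (k : G -> V) : uniq l -> {subset l <= S} ->
    \sum_(h <- S) (if h \in l then k h else 0) = \sum_(h <- l) k h.
  move=> ul lS; rewrite -big_mkcond -big_filter; apply: perm_big.
  apply: uniq_perm => //; first by rewrite filter_uniq// undup_uniq.
  move=> h; rewrite mem_filter; case: (boolP (h \in l)) => //= hl; exact: lS.
have FV h : h \in S -> V_ h (F h).
  move=> _; apply: (ddB dV); case: ifP => [|_]; by [exact: fV|exact: fV'|exact: (dd0 dV)].
have F0 : \sum_(h <- S) F h = 0.
  rewrite /F big_split /= sumrN !ext// -?xE -?xE' ?subrr// => h;
    by rewrite mem_undup mem_cat => ->; rewrite ?orbT.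
have [gS|] := boolP (g \in S).
  have /eqP := dd_indep dV (undup_uniq _) FV F0 gS.
  by rewrite subr_eq0 => /eqP.
by rewrite mem_undup mem_cat negb_or => /andP[/negbTE-> /negbTE->].
Qed.

Lemma proj_id g x : V_ g x -> proj g x = x.
Proof.
move=> gx; rewrite (@proj_unique [:: g] (fun=> x))// ?mem_head//.
  by move=> h; rewrite inE => /eqP->.
by rewrite big_seq1.
Qed.

Lemma proj_neq g h x : V_ g x -> h != g -> proj h x = 0.
Proof.
move=> gx hg; rewrite (@proj_unique [:: g] (fun=> x))// ?inE ?(negbTE hg)//.
  by move=> k; rewrite inE => /eqP->.
by rewrite big_seq1.
Qed.

(** The support may be enlarged at will, so that several elements can be decomposed over a common
    list of degrees. *)
Lemma proj_supp x : exists2 s : seq G, uniq s & forall s' : seq G, uniq s' ->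
  {subset s <= s'} -> x = \sum_(g <- s') proj g x.
Proof.
have [[s f] [/= us fV xE]] := decomp x; exists s => // s' us' ss'.
rewrite (eq_bigr _ (fun g _ => proj_unique us fV xE g)) -big_mkcond -big_filter.
rewrite {1}xE; apply: perm_big; apply: uniq_perm => //; first exact: filter_uniq.
move=> g; rewrite mem_filter; case: (boolP (g \in s)) => //= gs; exact/esym/ss'.
Qed.

Lemma projB g : {morph proj g : x y / x - y}.
Proof.
move=> x y; have [s us xE] := proj_supp x; have [s' us' yE] := proj_supp y.
pose S := undup (s ++ s').
have xE' := xE S (undup_uniq _); have yE' := yE S (undup_uniq _).
rewrite (@proj_unique S (fun g => proj g x - proj g y)) ?undup_uniq//.
- case: ifP => //; rewrite mem_undup mem_cat => /negbT; rewrite negb_or => /andP[gs gs'].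
  have p0 (z : V) (l : seq G) : uniq l -> z = \sum_(h <- l) proj h z ->
      g \notin l -> proj g z = 0.
    move=> ul zE gl; rewrite (proj_unique ul _ zE) ?(negbTE gl)// => h _.
    exact: proj_hcomp.
  by rewrite (p0 x s) ?(p0 y s') ?subrr//; [exact: yE|exact: xE].
- by move=> h _; apply: (ddB dV); exact: proj_hcomp.
rewrite big_split sumrN /= -xE' -?yE'// => h hs; by rewrite mem_undup mem_cat hs ?orbT.
Qed.
HB.instance Definition _ g := GRing.isZmodMorphism.Build V V (proj g) (projB g).

Lemma hsum_hcomp (P : set G) g x : hsum V_ P x -> V_ g x -> ~ P g -> x = 0.
Proof.
move=> /(hsum_uniq (dd0 dV) (ddB dV))[s [f [us fP xE]]] gx Pg.
rewrite -(proj_id gx) (proj_unique us _ xE) => [|h /fP[]//].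
by case: ifP => // /fP[].
Qed.

End Projection.

Section Homogeneity.
Context (S : comNzRingType) (G : zmodType) (N : nat) (w : 'I_N -> G).
Implicit Types p q : {mpoly S[N]}.

Lemma mdegreeD m m' : mdegree w (m + m')%MM = mdegree w m + mdegree w m'.
Proof.
rewrite /mdegree -big_split; apply: eq_bigr => v _.
by rewrite mnmDE mulrnDr.
Qed.

Lemma homogeneousM d e p q : homogeneous w d p -> homogeneous w e q ->
  homogeneous w (d + e) (p * q).
Proof.
move=> hp hq m /msuppM_le/allpairsP[[a b] /= [ap bq ->]].
by rewrite mdegreeD (hp _ ap) (hq _ bq).
Qed.

Lemma homogeneous1 : homogeneous w 0 (1 : {mpoly S[N]}).
Proof.
move=> m; rewrite msupp1 inE => /eqP->.
by rewrite /mdegree big1 // => v _; rewrite mnm0E mulr0n.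
Qed.

Lemma homogeneousXn d p e : homogeneous w d p -> homogeneous w (d *+ e) (p ^+ e).
Proof.
move=> hp; elim: e => [|e IH]; first by rewrite mulr0n expr0; exact: homogeneous1.
by rewrite mulrS exprS; exact: homogeneousM.
Qed.

Lemma homogeneous_sgn n (K : {set 'I_n}) v : homogeneous w 0 (sgn {mpoly S[N]} K v).
Proof.
rewrite /sgn -[0](mul0rn _ #|[set i in K | (i < v)%N]|); apply: homogeneousXn => m.
by rewrite (perm_mem (msuppN _)) => /homogeneous1.
Qed.

Lemma homogeneousX v : homogeneous w (w v) ('X_v : {mpoly S[N]}).
Proof.
move=> m; rewrite msuppX inE => /eqP->; rewrite /mdegree (bigD1 v)//= big1 => [|u uv].
  by rewrite mnm1E eqxx mulr1n addr0.
by rewrite mnm1E eq_sym (negbTE uv) mulr0n.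
Qed.

Lemma homogeneous_unique d e p : homogeneous w d p -> homogeneous w e p -> p != 0 -> d = e.
Proof.
move=> hp hq; rewrite -msupp_eq0; case mp : (msupp p) => [//|m l] _.
have mm : m \in msupp p by rewrite mp mem_head.
by rewrite -(hp _ mm) (hq _ mm).
Qed.

Lemma homogeneous_prod (I : finType) (J : {set I}) (d : I -> G) (f : I -> {mpoly S[N]}) :
  (forall i, homogeneous w (d i) (f i)) ->
  homogeneous w (\sum_(i in J) d i) (\prod_(i in J) f i).
Proof.
move=> hf; elim/big_ind2: _ => // [|d1 p d2 q]; first exact: homogeneous1.
by move=> h1 h2; exact: homogeneousM.
Qed.

Context (M : gradedModule S w).

Definition hproj : G -> M -> M := proj (hcompP M).

HB.instance Definition _ g := GRing.isZmodMorphism.Build M M (hproj g)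
  (projB (hcompP M) g).

Lemma hprojZ d g p (x : M) : homogeneous w d p ->
  hproj (d + g) (p *: x) = p *: hproj g x.
Proof.
move=> hp; have [s us xE] := proj_supp (hcompP M) x.
have {}xE := xE s us (fun _ => id).
rewrite [in LHS]xE scaler_sumr raddf_sum /= (eq_bigr (fun h =>
    if h == g then p *: hproj g x else 0)) => [|h _]; last first.
  have hx := hcompZ hp (proj_hcomp (hcompP M) h x).
  case: eqVneq => [->|hg]; first by rewrite /hproj proj_id//; apply: hcompZ hp (proj_hcomp _ _ _).
  by rewrite /hproj (proj_neq (hcompP M) hx)//; apply: contra_neq hg => /addrI.
have -> := sum_seq_delta g (p *: hproj g x) us; case: ifP => // /negbT gs.
rewrite /hproj (proj_unique (hcompP M) us _ xE) ?(negbTE gs) ?scaler0// => h _.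
exact: proj_hcomp.
Qed.

End Homogeneity.
Arguments hproj {S G N w} M g x.


(** * Degree projections on localizations and on Cech complexes *)

Section GradedLocalization.
Context (S : comNzRingType) (G : zmodType) (N : nat) (w : 'I_N -> G).
Context (M : gradedModule S w).
Implicit Types (a h p : {mpoly S[N]}) (d g : G).

Definition lproj a da g (x : loc M a) : loc M a :=
  frac a (hproj M (da *+ (repr x).2 + g) (repr x).1) (repr x).2.

(** Independence of the representative: the equality of fractions is an equality of multiples by
    powers of the homogeneous [a], and it can be projected to a single degree. *)
Lemma lprojE a da g (m : M) e : homogeneous w da a ->
  lproj da g (frac a m e) = frac a (hproj M (da *+ e + g) m) e.
Proof.
move=> ha; have [n E] := repr_frac a m e; apply/fracP; exists n.
case: (repr _) E => [u e'] /= E.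
rewrite -!(hprojZ _ _ (homogeneousXn ha)) E; congr (hproj M _ _).
by rewrite !mulrnDr !addrA; congr (_ + _); rewrite -!addrA [da *+ e' + _]addrC.
Qed.

Lemma lprojB a da g : homogeneous w da a -> {morph @lproj a da g : x y / x - y}.
Proof.
move=> ha; elim/(@frac_ind _ M a) => m e; elim/(@frac_ind _ M a) => m' e'.
have fN (z : M) k : - frac a z k = frac a (- z) k by exact: loc_oppE.
rewrite fN fracD !(lprojE _ _ _ ha) fN fracD scalerN raddfB /= scalerN.
by congr frac; congr (_ - _); rewrite -(hprojZ _ _ (homogeneousXn ha)) mulrnDr;
  congr (hproj M _ _); rewrite addrA// [da *+ e' + _]addrC.
Qed.

Lemma lproj0 a da g : homogeneous w da a -> @lproj a da g 0 = 0.
Proof. by move=> ha; rewrite -{1}(subrr 0) (lprojB _ ha) subrr. Qed.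

Lemma lproj_sum a da g (I : Type) (s : seq I) (P : pred I) (F : I -> loc M a) :
  homogeneous w da a ->
  lproj da g (\sum_(i <- s | P i) F i) = \sum_(i <- s | P i) lproj da g (F i).
Proof.
move=> ha; elim/big_rec2: _ => [|i x y _ <-]; first exact: lproj0.
by rewrite -{1}[y]opprK -[- y]sub0r !(lprojB _ ha) lproj0// sub0r opprK.
Qed.

Lemma lprojZ a da g d p (x : loc M a) : homogeneous w da a -> homogeneous w d p ->
  lproj da (d + g) (p *: x) = p *: lproj da g x.
Proof.
move=> ha hp; elim/(@frac_ind _ M a): x => m e.
by rewrite fracZ !(lprojE _ _ _ ha) fracZ -(hprojZ _ _ hp) addrCA.
Qed.

Lemma lproj_idem a da g (x : loc M a) : homogeneous w da a ->
  lproj da g (lproj da g x) = lproj da g x.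
Proof.
move=> ha; elim/(@frac_ind _ M a): x => m e; rewrite !(lprojE _ _ _ ha).
by rewrite /hproj proj_id//; exact: proj_hcomp.
Qed.

Lemma lproj_loc_map a a' h da dh g (x : loc M a) : a' = h * a ->
  homogeneous w da a -> homogeneous w dh h ->
  lproj (dh + da) g (loc_map a' h x) = loc_map a' h (lproj da g x).
Proof.
move=> aE ha hh; have ha' : homogeneous w (dh + da) a'.
  by rewrite aE; exact: homogeneousM.
elim/(@frac_ind _ M a): x => m e.
rewrite (lprojE _ _ _ ha) !(loc_mapE _ _ aE) (lprojE _ _ _ ha').
by rewrite mulrnDl -addrA (hprojZ _ _ (homogeneousXn hh)).
Qed.

Lemma lproj_loc_hcomp a da g (x : loc M a) : homogeneous w da a ->
  loc_hcomp g (lproj da g x).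
Proof.
move=> ha; elim/(@frac_ind _ M a): x => m e; rewrite (lprojE _ _ _ ha).
exists da, (hproj M (da *+ e + g) m), e; split=> //; exact: proj_hcomp.
Qed.

Lemma lproj_id a da g (x : loc M a) : homogeneous w da a ->
  loc_hcomp g x -> lproj da g x = x.
Proof.
move=> ha [d [m [e [hd gm ->]]]].
(* In [loc_hcomp] the degree of [a] is existential. It is determined by [a] unless [a = 0], and then
   the localization is zero. *)
have [a0|a0] := eqVneq a 0.
  have fr0 (y : loc M a) : y = 0.
    elim/(@frac_ind _ M a): y => m' e'; apply/frac_eq0; exists 1%N.
    by rewrite expr1 a0 scale0r.
  by rewrite [RHS]fr0 [LHS]fr0.
rewrite (lprojE _ _ _ ha) (homogeneous_unique ha hd a0).
by rewrite /hproj proj_id.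
Qed.

End GradedLocalization.

Section GradedCech.
Context (S : comNzRingType) (G : zmodType) (N : nat) (w : 'I_N -> G).
Context (M : gradedModule S w) (r : nat) (f : 'I_r -> {mpoly S[N]}).
(* The degrees of the generators have to be fixed because 0 is homogeneous of
   every degree. *)
Context (df : 'I_r -> G) (hf : forall i, homogeneous w (df i) (f i)).
Notation cochain := (cochain M f).
Implicit Types (c : cochain) (g : G) (J : {set 'I_r}).

Let degJ J := \sum_(i in J) df i.
Let homJ J : homogeneous w (degJ J) (subprod f J) := homogeneous_prod (J := J) hf.

Definition cproj p g c : cochain :=
  fun J => if #|J| == p then lproj (degJ J) g (c J) else 0.

Lemma cprojB p g : {morph cproj p g : c c' / c - c'}.
Proof.
move=> c c'; apply: cochainP => J; rewrite cochainD cochainN /cproj.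
by case: ifP => _; rewrite ?subrr// -(lprojB _ (@homJ J)).
Qed.
HB.instance Definition _ p g :=
  GRing.isZmodMorphism.Build cochain cochain (cproj p g) (cprojB p g).

Lemma cprojZ p g d (q : {mpoly S[N]}) c : homogeneous w d q ->
  cproj p (d + g) (q *: c) = q *: cproj p g c.
Proof.
move=> hq; apply: cochainP => J; rewrite cochainZ /cproj.
by case: ifP => _; rewrite ?scaler0// -(lprojZ _ _ (@homJ J) hq).
Qed.

Lemma cproj_idem p g c : cproj p g (cproj p g c) = cproj p g c.
Proof.
apply: cochainP => J; rewrite /cproj; case: ifP => // Jp.
by rewrite Jp; apply: lproj_idem; exact: homJ.
Qed.

Lemma cproj_cech_d p g c : cproj p.+1 g (cech_d c) = cech_d (cproj p g c).
Proof.
apply: cochainP => J; rewrite cech_dE /cproj.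
case: (eqVneq #|J| p.+1) => [Jp|Jp]; last first.
  rewrite big1// => j jJ; rewrite ifF ?(loc_map0 _ (subprodD1 f jJ)) ?scaler0//.
  by apply: contraNF Jp; rewrite (cardsD1 j J) jJ => /eqP->.
rewrite cech_dE (lproj_sum _ _ _ _ (@homJ J)); apply: eq_bigr => j jJ.
rewrite ifT; last by move: Jp; rewrite (cardsD1 j J) jJ add1n => -[->].
have degE : degJ J = df j + degJ (J :\ j) by rewrite /degJ (big_setD1 j).
rewrite -(lproj_loc_map _ _ (subprodD1 f jJ) (@homJ _) (@hf j)) -degE.
rewrite -(lprojZ _ _ (@homJ J) (d := 0)) ?add0r//.
exact: homogeneous_sgn.
Qed.

Lemma cproj0_cech_d g c : cproj 0 g (cech_d c) = 0.
Proof.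
apply: cochainP => J; rewrite /cproj cards_eq0; case: eqP => // ->.
by rewrite cech_dE big_set0 lproj0.
Qed.

Definition cech_exact p g := forall c, cproj p g c = c -> cech_d c = 0 ->
  exists b, c = cech_d b.

Lemma eq_cproj p g c c' : (forall J, #|J| = p -> c J = c' J) -> cproj p g c = cproj p g c'.
Proof.
by move=> cc'; apply: cochainP => J; rewrite /cproj; case: eqP => // /cc'->.
Qed.

(** The two sides differ in that cocycles and coboundaries are tested on sets of a given size only,
    or everywhere. Cutting cochains down with [cproj] passes from one to the other. *)
Lemma cech_exactP p g : cech_exact p g <-> ~ local_cohomology_neq0 M f p g.
Proof.
split=> [ex [c [hc dc ncob]]|h c cE dc].
  case: (ex (cproj p g c)) => [||b bE]; first exact: cproj_idem.
    rewrite -cproj_cech_d -(raddf0 (cproj p.+1 g)); apply: eq_cproj => J Jp.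
    exact: dc.
  apply: ncob; exists b => J Jp; rewrite -bE /cproj Jp eqxx lproj_id//.
  exact: hc.
apply: contrapT => ncob; apply: h; exists c; split.
- by move=> J Jp; rewrite -cE /cproj Jp eqxx; exact: lproj_loc_hcomp.
- by move=> J _; rewrite dc.
case=> b bE; apply: ncob.
case: p bE cE => [|p] bE cE.
  (* In degree 0 a coboundary vanishes at the empty set, so [c] itself is zero. *)
  exists 0; rewrite raddf0 -cE -(cproj0_cech_d g b); exact: eq_cproj.
exists (cproj p g b); rewrite -cproj_cech_d -cE; exact: eq_cproj.
Qed.

End GradedCech.


(** * From Cech exactness to Koszul exactness *)

Lemma setU1D (T : finType) (v : T) (K P : {set T}) :
  v \in P -> (v |: K) :\: P = K :\: P.
Proof.
move=> vP; have /eqP : [set v] :\: P == set0 by rewrite setD_eq0 sub1set.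
by rewrite setDUl => ->; rewrite set0U.
Qed.

Lemma card_setU1I (T : finType) (v : T) (K P : {set T}) :
  v \in P -> v \notin K -> #|(v |: K) :&: P| = #|K :&: P|.+1.
Proof.
move=> vP vK; rewrite setIUl (_ : [set v] :&: P = [set v]); last first.
  by apply/setIidPl; rewrite sub1set.
by rewrite cardsU1 inE (negbTE vK).
Qed.

Section KoszulMore.
Context (A : comNzRingType) (n : nat) (x : 'I_n -> A) (P : {set 'I_n}).

Lemma koszul_d_map (V W : lmodType A) (phi : {linear V -> W}) (z : {ffun {set 'I_n} -> V}) :
  koszul_d x P [ffun K => phi (z K)] = [ffun K => phi (koszul_d x P z K)].
Proof.
apply/ffunP=> K; rewrite ffunE !kdE raddf_sum /=; apply: eq_bigr => v _.
by rewrite ffunE linearZ.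
Qed.

(** On a cycle the homotopy reads [h *: z = koszul_d x P s], and [s] can be divided by [h]. *)
Lemma koszul_exact_of_unit (V : lmodType A) (a : 'I_n -> A) (h := \sum_(v in P) a v * x v) :
  (forall y : V, exists y', h *: y' = y) -> (forall y : V, h *: y = 0 -> y = 0) ->
  forall z : {ffun {set 'I_n} -> V}, koszul_d x P z = 0 -> exists y, z = koszul_d x P y.
Proof.
move=> /choice[dv hdv] inj z z0.
have := koszul_homotopy x P a z; rewrite z0.
rewrite [X in _ + X]big1 ?addr0 => [|v _]; last by rewrite raddf0 scaler0.
set s := \sum_(v in P) _ => hE.
exists [ffun K => dv (s K)]; apply/eqP; rewrite -subr_eq0; apply/eqP/ffunP=> K.
rewrite [RHS]ffunE; apply: inj; rewrite -[RHS](subrr ((h *: z) K)) -{2}hE -/h.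
transitivity ((h *: (z - koszul_d x P [ffun K => dv (s K)])) K); first by rewrite [RHS]ffunE.
rewrite scalerBr -linearZ /=.
have -> : h *: [ffun K => dv (s K)] = s.
  by apply/ffunP=> L; rewrite !ffunE; exact: hdv.
by rewrite !ffunE.
Qed.

Lemma koszul_d_cech_aug (M : lmodType A) (r : nat) (f : 'I_r -> A)
    (z : {ffun {set 'I_n} -> M}) :
  koszul_d x P [ffun K => cech_aug f (z K)] = [ffun K => cech_aug f (koszul_d x P z K)].
Proof. exact: (koszul_d_map (@cech_aug _ M r f) z). Qed.

End KoszulMore.

Section CechToKoszul.
Context (S : comNzRingType) (G : zmodType) (N : nat) (w : 'I_N -> G).
Context (M : gradedModule S w) (r : nat) (f : 'I_r -> {mpoly S[N]}).
Context (df : 'I_r -> G) (hf : forall i, homogeneous w (df i) (f i)).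
Notation R := {mpoly S[N]}.
Notation cochain := (cochain M f).
Notation chain := {ffun {set 'I_N} -> cochain}.
Local Notation aug := (@cech_aug _ M r f).
Notation X := (fun v : 'I_N => 'X_v : R).
Implicit Types (g : G) (K : {set 'I_N}) (J : {set 'I_r}).

Definition kdeg K : G := \sum_(v in K) w v.

Lemma kdegU K v : v \notin K -> kdeg (v |: K) = w v + kdeg K.
Proof. by move=> vK; rewrite /kdeg big_setU1. Qed.

Definition chain_d (z : chain) : chain := [ffun K => cech_d (z K)].

Lemma chain_dB : {morph chain_d : x y / x - y}.
Proof. by move=> x y; apply/ffunP=> K; rewrite !ffunE raddfB. Qed.
HB.instance Definition _ := GRing.isZmodMorphism.Build chain chain chain_d chain_dB.

(* Only the variables of P count for the Koszul degree q; the inert ones are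
   constrained by Q. *)
Definition bproj (P : {set 'I_N}) (Q : pred {set 'I_N}) g p q (z : chain) : chain :=
  [ffun K : {set 'I_N} => if (#|K :&: P| == q) && Q (K :\: P)
    then cproj df p (g - kdeg K) (z K) else 0].

Section Fixed.
Context (P : {set 'I_N}) (Q : pred {set 'I_N}) (g : G).
Notation bproj := (bproj P Q g).

Lemma bprojB p q : {morph bproj p q : x y / x - y}.
Proof.
move=> x y; apply/ffunP=> K; rewrite !ffunE; case: ifP => _; last by rewrite subrr.
by rewrite (cprojB hf).
Qed.

Lemma bproj_idem p q z : bproj p q (bproj p q z) = bproj p q z.
Proof.
by apply/ffunP=> K; rewrite !ffunE; case: ifP => // ->; rewrite (cproj_idem hf).
Qed.

Lemma cproj0 p d : cproj df p d (0 : cochain) = 0.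
Proof. by rewrite -{1}(subrr (0 : cochain)) (cprojB hf) subrr. Qed.

Lemma cproj_sum p d (I : Type) (s : seq I) (C : pred I) (F : I -> cochain) :
  cproj df p d (\sum_(i <- s | C i) F i) = \sum_(i <- s | C i) cproj df p d (F i).
Proof.
elim/big_rec2: _ => [|i x y _ <-]; first exact: cproj0.
by rewrite -{1}[y]opprK -[- y]sub0r !(cprojB hf) cproj0 sub0r opprK.
Qed.

Lemma bproj_koszul_d p q z : bproj p q (koszul_d X P z) = koszul_d X P (bproj p q.+1 z).
Proof.
apply/ffunP=> K; rewrite kdE ffunE kdE.
case: ifPn => [/andP[/eqP Kq QK]|KqQ]; last first.
  rewrite big1// => v /andP[vP vK]; rewrite ffunE ifN ?scaler0//.
  by apply: contra KqQ; rewrite card_setU1I// eqSS setU1D.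
rewrite cproj_sum; apply: eq_bigr => v /andP[vP vK].
rewrite ffunE ifT; last by rewrite card_setU1I// Kq eqxx setU1D.
rewrite kdegU// opprD addrA -(@cprojZ _ _ _ _ _ _ _ _ hf p _ (w v)).
  by congr cproj; rewrite addrCA addrA subrK.
by rewrite -[w v]add0r; apply: homogeneousM; [exact: homogeneous_sgn|exact: homogeneousX].
Qed.

Lemma bproj_chain_d p q z : bproj p.+1 q (chain_d z) = chain_d (bproj p q z).
Proof.
apply/ffunP=> K; rewrite !ffunE; case: ifP => _; last by rewrite raddf0.
by rewrite (cproj_cech_d hf).
Qed.

Lemma bproj0_chain_d q z : bproj 0 q (chain_d z) = 0.
Proof. by apply/ffunP=> K; rewrite !ffunE (cproj0_cech_d hf) if_same. Qed.

Lemma chain_d_koszul_d z : koszul_d X P (chain_d z) = chain_d (koszul_d X P z).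
Proof. exact: (koszul_d_map X P (@cech_d _ M r f) z). Qed.

Lemma chain_d_chain_d z : chain_d (chain_d z) = 0.
Proof. by apply/ffunP=> K; rewrite !ffunE cech_d_cech_d. Qed.

(** In a column of positive Cech degree each set [J] contains some [j]. Then [f j], a combination of
    the variables of [P], is invertible on the localization at [J], and the Koszul complex there is
    exact. *)
Lemma koszul_columns (a : 'I_r -> 'I_N -> R) p q z :
  (forall i, f i = \sum_(v in P) a i v * 'X_v) ->
  bproj p.+1 q z = z -> koszul_d X P z = 0 -> exists y, z = koszul_d X P y.
Proof.
move=> fE zE z0.
have kdJ (y : chain) J : [ffun K => koszul_d X P y K J] = koszul_d X P [ffun K => y K J].
  apply/ffunP=> K; rewrite ffunE !kdE cochain_sum; apply: eq_bigr => v _.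
  by rewrite ffunE.
have /(_ _)/cid zJ J : exists y : {ffun {set 'I_N} -> loc M (subprod f J)},
    [ffun K => z K J] = koszul_d X P y.
  have z0J : koszul_d X P [ffun K => z K J] = 0.
    by rewrite -kdJ z0; apply/ffunP=> K; rewrite !ffunE.
  have [J0|[j jJ]] := set_0Vmem J.
    exists 0; rewrite raddf0; apply/ffunP=> K; rewrite !ffunE -zE ffunE.
    by case: ifP => // _; rewrite /cproj J0 cards0.
  have gE := subprodD1 f jJ.
  apply: (koszul_exact_of_unit (a := a j)) z0J; rewrite -fE => y.
    exact: loc_div gE.
  exact: loc_scale_inj gE.
exists [ffun K => (fun J => sval (zJ J) K) : cochain].
apply/ffunP=> K; apply: cochainP => J.
transitivity ([ffun K => z K J] K); first by rewrite ffunE.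
rewrite (svalP (zJ J)) !kdE cochain_sum; apply: eq_bigr => v _.
by rewrite ffunE.
Qed.

End Fixed.

Lemma cproj_cech_aug g (m : M) : cproj df 0 g (cech_aug f m) = cech_aug f (hproj M g m).
Proof.
apply: cochainP => J; rewrite /cproj /cech_aug cards_eq0; case: eqP => // ->.
rewrite lprojE ?mulr0n ?add0r// big_set0 subprod0; exact: homogeneous1.
Qed.

(** The shift by [kdeg K] accounts for the degree of the basis element of [K], so that the Koszul
    differential preserves [g]. *)
Definition kchain g (C : pred {set 'I_N}) (z : {ffun {set 'I_N} -> M}) : Prop :=
  forall K, hcomp M (g - kdeg K) (z K) /\ (~~ C K -> z K = 0).

(** The staircase in the Cech-Koszul double complex. Its rows are Cech complexes of [M] shifted by
    [kdeg K], and only the sets [K] with [i + p] variables in [P] are met in Cech degree [p]. *)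
Theorem cech_to_koszul (P : {set 'I_N}) (Q : pred {set 'I_N}) (a : 'I_r -> 'I_N -> R)
    (i : nat) g (z : {ffun {set 'I_N} -> M}) :
  (forall j, f j = \sum_(v in P) a j v * 'X_v) ->
  (forall p K, #|K :&: P| = (i + p)%N -> Q (K :\: P) -> cech_exact M f df p (g - kdeg K)) ->
  kchain g (fun K => (#|K :&: P| == i) && Q (K :\: P)) z -> koszul_d X P z = 0 ->
  exists2 y, kchain g (fun K => (#|K :&: P| == i.+1) && Q (K :\: P)) y & z = koszul_d X P y.
Proof.
move=> fE ex zC z0;
pose z' : chain := [ffun K => aug (z K)].
have Az' : bproj P Q g 0 i z' = z'.
  apply/ffunP=> K; rewrite !ffunE; have [hz z0K] := zC K; case: ifPn => [_|/z0K->].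
    by rewrite cproj_cech_aug /hproj proj_id.
  by rewrite raddf0.
have [||||||||||||y yE] := columns_exact_of_rows (d := koszul_d X P) (delta := chain_d)
    (pi := bproj P Q g) _ _ _ _ _ _ _ _ (r := r) _ _ _ Az'.
- exact: koszul_d_koszul_d.
- exact: chain_d_chain_d.
- exact: chain_d_koszul_d.
- exact: bproj_idem.
- exact: bprojB.
- exact: bproj_koszul_d.
- exact: bproj_chain_d.
- exact: bproj0_chain_d.
(* No set of indices has more than [r] elements. *)
- move=> p q x xE rp; apply/ffunP=> K; rewrite -xE !ffunE; case: ifP => // _.
  apply: cochainP => J; rewrite /cproj ifF//.
  by apply/negbTE; have := subset_leq_card (subsetT J); rewrite cardsT card_ord; lia.
- by move=> p q x; exact: koszul_columns.
- move=> p x xE dx0.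
  have /choice[b bE] : forall K, exists b : cochain, x K = cech_d b.
    move=> K; have xK : cech_d (x K) = 0 by have /ffunP/(_ K) := dx0; rewrite !ffunE.
    have /ffunP/(_ K) := xE; rewrite ffunE.
    case: ifP => [/andP[/eqP Kp QK] xKE|_ <-]; last by exists 0; rewrite raddf0.
    exact: (ex p K).
  by exists [ffun K => b K]; apply/ffunP=> K; rewrite !ffunE.
- by rewrite /= /z' koszul_d_cech_aug z0; apply/ffunP=> K; rewrite !ffunE raddf0.
have {}yE : z' = koszul_d X P (bproj P Q g 0 i.+1 y) by rewrite -bproj_koszul_d -yE Az'.
(* In Cech degree 0 only the empty set of generators matters, so the cochains come from [M]. *)
have /choice[m mE] : forall K, exists m : M, bproj P Q g 0 i.+1 y K = aug m.
  move=> K; apply: cech_aug_surj => J J0; rewrite ffunE; case: ifP => // _.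
  by rewrite /cproj cards_eq0 (negbTE J0).
exists [ffun K => m K].
  move=> K; rewrite ffunE.
  have /ffunP/(_ K) := bproj_idem P Q g 0 i.+1 y; rewrite [LHS]ffunE mE.
  case: ifP => [_|_ m0]; last first.
    split=> [|_]; last by apply: (@cech_aug_inj _ M r f); rewrite raddf0.
    have -> : m K = 0 by apply: (@cech_aug_inj _ M r f); rewrite raddf0.
    exact: (dd0 (hcompP M)).
  rewrite cproj_cech_aug => /(@cech_aug_inj _ M r f) <-; split=> //.
  exact: proj_hcomp.
apply/ffunP=> K; apply: (@cech_aug_inj _ M r f).
transitivity (z' K); first by rewrite ffunE.
transitivity ([ffun K => aug (koszul_d X P [ffun K => m K] K)] K); last by rewrite ffunE.
rewrite yE -koszul_d_cech_aug; congr (koszul_d X P _ K); apply/ffunP=> L.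
by rewrite mE !ffunE.
Qed.

End CechToKoszul.


(** * From Koszul exactness to Cech exactness *)

Section KoszulToCech.
Context (S : comNzRingType) (N : nat) (M : gradedModule S (fun _ : 'I_N => 1 : int)).
Context (r : nat) (f : 'I_r -> {mpoly S[N]}) (df : 'I_r -> int).
Context (hf : forall i, homogeneous (fun _ : 'I_N => 1 : int) (df i) (f i)).
Notation R := {mpoly S[N]}.
Notation cochain := (cochain M f).
Notation chain := {ffun {set 'I_N} -> cochain}.
Local Notation X := (fun v : 'I_N => 'X_v : R).
Implicit Types (K : {set 'I_N}) (c : cochain).

Lemma kdeg1 K : kdeg (fun _ : 'I_N => 1 : int) K = #|K|%:Z.
Proof. by rewrite /kdeg sumr_const natz. Qed.

Context (a : 'I_r -> 'I_N -> R) (fE : forall j, f j = \sum_v a j v * 'X_v).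
Context (b : 'I_N -> 'I_r -> R) (XE : forall v, 'X_v = \sum_j b v j * f j).
Context (tau : int).
Hypothesis linear_koszul : forall q D (z : {ffun {set 'I_N} -> M}),
  kchain D (fun K => #|K| == q) z -> koszul_d X setT z = 0 -> q%:Z + tau < D ->
  exists y, z = koszul_d X setT y.

Local Notation bproj := (bproj df setT predT).

(* A class c killed by all the variables gives the Koszul cycle Z, with c at the
   top exterior power. *)
Lemma cech_socle p d c :
  (forall p' d', (p' < p)%N -> tau < p'%:Z + d' -> cech_exact M f df p' d') ->
  tau < p%:Z + d -> cproj df p d c = c -> cech_d c = 0 ->
  (forall v, exists u, 'X_v *: c = cech_d u) -> exists u, c = cech_d u.
Proof.
move=> IH tpd cE dc /choice[u uE].
pose Z : chain := [ffun K => if K == setT then c else 0].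
(* The primitives [u v] of ['X_v *: c], placed in exterior degree one below the top, make the Koszul
   boundary of [Z] a Cech boundary. *)
pose Y : chain := [ffun K : {set 'I_N} => \sum_(v in setT | v \notin K)
  sgn R K v *: (if v |: K == setT then u v else 0)].
have AZ : bproj (d + N%:Z) p N Z = Z.
  apply/ffunP=> K; rewrite !ffunE; case: (eqVneq K setT) => [->|_].
    by rewrite setTI cardsT card_ord eqxx /= kdeg1 cardsT card_ord addrK.
  by rewrite (cproj0 _ hf) if_same.
have dZ : koszul_d X setT Z = chain_d Y.
  apply/ffunP=> K; rewrite kdE !ffunE raddf_sum; apply: eq_bigr => v _.
  rewrite /= ffunE cech_dZ -scalerA; congr (_ *: _).
  by case: ifP => _; rewrite ?uE// !raddf0.
have [|||||||||||||V [U ZE]] := socle_transgression (d := koszul_d X setT)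
    (delta := @chain_d _ _ _ _ M _ f) (pi := bproj (d + N%:Z)) _ _ _ _ _ _ _ _ _ _ _ _ AZ.
- exact: koszul_d_koszul_d.
- exact: chain_d_chain_d.
- exact: chain_d_koszul_d.
- exact: bproj_idem.
- exact: bprojB.
- exact: bproj_koszul_d.
- exact: bproj_chain_d.
- exact: bproj0_chain_d.
- by move=> p' q x; apply: koszul_columns => // i; rewrite fE; apply: eq_bigl => v; rewrite inE.
(* Here [q + p = N], so [tau < p + d] becomes [q + tau < d + N]: column 0 is exact by
   [linear_koszul]. *)
- move=> q x qpN xE dx0.
  have /choice[m mE] : forall K, exists m : M, x K = cech_aug f m.
    move=> K; apply: cech_aug_surj => J J0; rewrite -xE ffunE; case: ifP => // _.
    by rewrite /cproj cards_eq0 (negbTE J0).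
  have xm : x = [ffun K => cech_aug f ([ffun L => m L] K)].
    by apply/ffunP=> K; rewrite mE !ffunE.
  have [|||y yE] := @linear_koszul q (d + N%:Z) [ffun L => m L].
  + move=> K; rewrite ffunE; have /ffunP/(_ K) := xE; rewrite ffunE setIT andbT mE.
    case: ifP => [_|_ m0]; last first.
      have -> : m K = 0 by apply: (@cech_aug_inj _ M r f); rewrite raddf0.
      by split=> //; exact: (dd0 (hcompP M)).
    rewrite cproj_cech_aug => /(@cech_aug_inj _ M r f) <-; split=> //.
    exact: proj_hcomp.
  + apply/ffunP=> K; apply: (@cech_aug_inj _ M r f); rewrite ffunE raddf0.
    have /ffunP/(_ K) := dx0; rewrite xm.
    by rewrite /= koszul_d_cech_aug !ffunE.
  + by lia.
  exists [ffun K => cech_aug f (y K)].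
  by rewrite /= koszul_d_cech_aug -yE xm.
- move=> p' x xE; apply/ffunP=> K; rewrite /= kdE ffunE big1// => v /andP[_ vK].
  by rewrite -xE ffunE setIT cardsU1 vK add1n scaler0.
(* A set [K] of size [q] leaves degree [d + N - q], and [p' + (d + N - q) = p + d + 1] exceeds
   [tau]; the hypothesis on smaller [p'] applies. *)
- move=> p' q x p'p pq xE dx0.
  have /choice[y yE] : forall K, exists y : cochain, x K = cech_d y.
    move=> K; have xK : cech_d (x K) = 0 by have /ffunP/(_ K) := dx0; rewrite !ffunE.
    have /ffunP/(_ K) := xE; rewrite ffunE setIT kdeg1.
    case: ifP => [/andP[/eqP Kp _] xKE|_ <-]; last by exists 0; rewrite raddf0.
    by apply: IH xKE xK => //; lia.
  by exists [ffun K => y K]; apply/ffunP=> K; rewrite !ffunE.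
- by exists Y.
(* The top exterior power receives no Koszul boundary. *)
exists (U setT); have /ffunP/(_ setT) := ZE; rewrite !ffunE eqxx => ->.
by rewrite kdE big1 ?add0r// => v; rewrite !inE.
Qed.

(** A power of each variable kills the class, hence so do all monomials of some large degree. That
    degree is lowered step by step with [cech_socle]; multiplying by a variable raises [d], which
    stays in the range. *)
Theorem koszul_to_cech p d : tau < p%:Z + d -> cech_exact M f df p d.
Proof.
elim/ltn_ind: p d => p IH d tpd c cE dc.
(* If monomials of degree [s + 1] kill the class of [c'], those of degree [s] kill its multiples by
   the variables. These multiples are then zero by induction, and [cech_socle] applies. *)
have mono s : forall d' c', tau < p%:Z + d' -> cproj df p d' c' = c' -> cech_d c' = 0 ->
    (forall m, mdeg m = s -> exists u, 'X_[m] *: c' = cech_d u) ->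
    exists u, c' = cech_d u.
  elim: s => [|s IHs] d' c' td cE' dc' hm.
    by have [u uE] := hm 0%MM mdeg0; exists u; rewrite -uE mpolyX0 scale1r.
  apply: (cech_socle (fun p' e h => IH p' h e) td) => // v.
  apply: (IHs (1 + d')); first by lia.
  - by rewrite (cprojZ hf)// ?cE'//; exact: homogeneousX.
  - by rewrite cech_dZ dc' scaler0.
  move=> m ms; have [|u uE] := hm (m + U_(v))%MM; first by rewrite mdegD mdeg1 ms addn1.
  by exists u; rewrite -uE mpolyXD scalerA.
have /choice[L LP] : forall v, exists L, exists u, 'X_v ^+ L *: c = cech_d u.
  by move=> v; rewrite XE; exact: cech_torsion.
pose L0 := \max_v L v.
(* Pigeonhole: a monomial in [N] variables of degree above [N * L0] has an exponent at least [L v]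
   for some [v]. *)
apply: (mono (N * L0).+1 d c) => // m mE.
have [v Lv] : exists v, (L v <= m v)%N.
  apply: contrapT => /forallNP h; move: mE; rewrite mdegE => mE.
  suff : (\sum_(i < N) m i <= N * L0)%N by rewrite mE ltnn.
  rewrite -[X in (_ <= X * _)%N]card_ord -sum_nat_const; apply: leq_sum => i _.
  have /negP := h i; rewrite -ltnNge => /ltnW /leq_trans -> //.
  exact: leq_bigmax.
have [u uE] := LP v; rewrite mpolyXE_id (bigD1 v)//= -(subnK Lv) exprD.
exists ((\prod_(i < N | i != v) 'X_i ^+ m i * 'X_v ^+ (m v - L v)) *: u).
by rewrite cech_dZ -uE scalerA; congr (_ *: _); rewrite [LHS]mulrC -[RHS]mulrA.
Qed.

End KoszulToCech.


(** * The truncated Koszul complex *)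

Section KChain.
Context (S : comNzRingType) (G : zmodType) (N : nat) (w : 'I_N -> G).
Context (M : gradedModule S w).
Notation R := {mpoly S[N]}.
Notation chain := {ffun {set 'I_N} -> M}.
Local Notation X := (fun v : 'I_N => 'X_v : R).
Implicit Types (g : G) (K P : {set 'I_N}) (C D : pred {set 'I_N}) (z : chain).

Lemma kchain_sub g C D z : (forall K, C K -> D K) -> kchain g C z -> kchain g D z.
Proof.
move=> CD zC K; have [hz z0] := zC K; split=> // DK.
by apply: z0; apply: contra DK; exact: CD.
Qed.

Lemma kchain0 g C : kchain g C (0 : chain).
Proof. by move=> K; rewrite ffunE; split=> //; exact: (dd0 (hcompP M)). Qed.

Lemma kchainD g C z z' : kchain g C z -> kchain g C z' -> kchain g C (z + z').
Proof.
move=> zC zC' K; have [hz z0] := zC K; have [hz' z0'] := zC' K; rewrite ffunE.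
split; first exact: (dd_add (hcompP M)).
by move=> CK; rewrite z0// z0'// addr0.
Qed.

Lemma kchainB g C z z' : kchain g C z -> kchain g C z' -> kchain g C (z - z').
Proof.
move=> zC zC'; apply: kchainD => // K; have [hz' z0'] := zC' K; rewrite ffunE.
split; first exact: (dd_opp (hcompP M)).
by move=> CK; rewrite z0'// oppr0.
Qed.

Lemma kchain_koszul_d g C D P z :
  (forall K v, v \in P -> v \notin K -> C (v |: K) -> D K) ->
  kchain g C z -> kchain g D (koszul_d X P z).
Proof.
move=> CD zC K; rewrite kdE; split.
  apply: (subgroup_sum (dd0 (hcompP M)) (ddB (hcompP M)) (Q := fun v => _)) => v _ /andP[vP vK].
  have [hz _] := zC (v |: K).
  have -> : g - kdeg w K = w v + (g - kdeg w (v |: K)).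
    by rewrite kdegU// [RHS]addrC [w v + _]addrC opprD addrA subrK.
  apply: hcompZ hz; rewrite -[w v]add0r.
  by apply: homogeneousM; [exact: homogeneous_sgn|exact: homogeneousX].
move=> DK; rewrite big1// => v /andP[vP vK].
have [_ ->] := zC (v |: K); first by rewrite scaler0.
by apply: contra DK; exact: CD.
Qed.

Definition krestrict D z : chain := [ffun K => if D K then z K else 0].

Lemma kchain_restrict g C D z : kchain g C z -> kchain g (predI C D) (krestrict D z).
Proof.
move=> zC K; have [hz z0] := zC K; rewrite ffunE /=; split.
  by case: ifP => // _; exact: (dd0 (hcompP M)).
by case: ifP => // _; rewrite andbT.
Qed.

Lemma kchain_restrictB g C D z :
  kchain g C z -> kchain g (predD C D) (z - krestrict D z).
Proof.
move=> zC K; have [hz z0] := zC K; rewrite !ffunE /=; split.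
  apply: (ddB (hcompP M)) => //.
  by case: ifP => // _; exact: (dd0 (hcompP M)).
by case: (D K); rewrite ?subrr// subr0.
Qed.

Lemma koszul_d_eq0 P z K : (forall v, v \in P -> v \notin K -> z (v |: K) = 0) ->
  koszul_d X P z K = 0.
Proof. by move=> h; rewrite kdE big1// => v /andP[vP vK]; rewrite h// scaler0. Qed.

Lemma koszul_d_eq P z z' K : (forall v, v \in P -> v \notin K -> z (v |: K) = z' (v |: K)) ->
  koszul_d X P z K = koszul_d X P z' K.
Proof. by move=> h; rewrite !kdE; apply: eq_bigr => v /andP[vP vK]; rewrite h. Qed.

Lemma kdU P P' z : [disjoint P & P'] -> koszul_d X (P :|: P') z = koszul_d X P z + koszul_d X P' z.
Proof.
move=> dPP; by rewrite /koszul_d -bigU//=; apply: eq_bigl => v; rewrite !inE.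
Qed.

End KChain.

Section Truncated.
Context (S : comNzRingType) (k : nat) (n : 'I_k -> nat).
Notation N := (\sum_(i < k) n i)%N.
Context (M : gradedModule S (multideg n)) (mu t : 'rV[int]_k).
Hypothesis n_gt0 : forall i, (0 < n i)%N.
Hypothesis mu_t : forall i, mu 0 i + ((n i)%:Z - 1) <= t 0 i.
Notation R := {mpoly S[N]}.
Notation chain := {ffun {set 'I_N} -> M}.
Notation deg K := (kdeg (multideg n) K).
Local Notation X := (fun v : 'I_N => 'X_v : R).
Implicit Types (g : 'rV[int]_k) (K P : {set 'I_N}) (z : chain).

Definition block (j : 'I_k) : {set 'I_N} := [set v | tagnat.sig1 v == j].
Definition low (a : nat) : {set 'I_N} := [set v : 'I_N | (tagnat.sig1 v < a)%N].

Lemma degE K j : (deg K) 0 j = #|K :&: block j|%:Z.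
Proof.
rewrite /kdeg summxE -[RHS]natz -sum1_card natr_sum /=.
rewrite big_mkcond [RHS]big_mkcond; apply: eq_bigr => v _.
by rewrite !inE !mxE eqxx eq_sym /=; case: (v \in K) => //=; case: eqP.
Qed.

Lemma card_block j : #|block j| = n j.
Proof.
have Rinj : injective (@tagnat.Rank _ n j).
  move=> u v /(congr1 val)/eqP; rewrite tagnat.eq_Rank eqxx /= => /eqP uv.
  exact: val_inj.
rewrite -[RHS]card_ord -cardsT -(card_imset _ Rinj); apply: eq_card => v.
rewrite inE; apply/eqP/imsetP => [<-|[u _ ->]]; last exact: tagnat.Rank1K.
by exists (tagnat.sig2 v); rewrite ?inE// tagnat.sig2K.
Qed.

Hypothesis block_exact : forall j (Q : pred {set 'I_N}) i g z,
  (forall K, Q (K :\: block j) -> forall l, mu 0 l <= (g - deg K) 0 l) ->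
  kchain g (fun K => (#|K :&: block j| == i) && Q (K :\: block j)) z ->
  koszul_d X (block j) z = 0 ->
  exists2 y, kchain g (fun K => (#|K :&: block j| == i.+1) && Q (K :\: block j)) y
    & z = koszul_d X (block j) y.

(** By [degE], this says that coordinate [j] of [g - deg K] is at least [t 0 j] for the first [a]
    blocks. *)
Definition trunc a g K : bool :=
  [forall j : 'I_k, (j < a)%N ==> (t 0 j + #|K :&: block j|%:Z <= g 0 j)].

Lemma trunc_sub a g K K' : trunc a g K -> K' \subset K -> trunc a g K'.
Proof.
move=> /forallP tK sK; apply/forallP=> j; apply/implyP=> ja.
have := implyP (tK j) ja; have := subset_leq_card (setSI (block j) sK); lia.
Qed.

Section Step.
Context (a : nat) (ak : (a < k)%N).
Let ja : 'I_k := Ordinal ak.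

Lemma lowS : low a.+1 = low a :|: block ja.
Proof. by apply/setP=> v; rewrite !inE ltnS leq_eqVlt orbC -val_eqE. Qed.

Lemma low_block v : v \in low a -> v \in block ja = false.
Proof. by rewrite !inE -val_eqE /= => va; apply/negbTE; rewrite neq_ltn va. Qed.

Lemma block_low v : v \in block ja -> v \in low a = false.
Proof. by apply: contraTF => /low_block->. Qed.

Lemma disjoint_low_block : [disjoint low a & block ja].
Proof. by apply/pred0P=> v /=; apply/negbTE/negP=> /andP[/low_block->]. Qed.

Lemma cardU1_notin v K P : v \notin P -> #|(v |: K) :&: P| = #|K :&: P|.
Proof.
move=> vP; congr #|pred_of_set _|; apply/setP=> u; rewrite !inE.
by case: eqP => // ->; rewrite (negbTE vP) !andbF.
Qed.

Lemma truncDblock g K : trunc a g (K :\: block ja) = trunc a g K.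
Proof.
apply: eq_forallb => j; case: (boolP (j < a)%N) => //= jlt.
rewrite (_ : (K :\: block ja) :&: block j = K :&: block j)//.
apply/setP=> u; rewrite !inE; case: (eqVneq (tagnat.sig1 u) j) => [->|]; rewrite ?andbF//.
by rewrite -val_eqE /= (ltn_eqF jlt).
Qed.

Lemma truncU1block g v K : v \in block ja -> trunc a g (v |: K) = trunc a g K.
Proof. by move=> vb; rewrite -truncDblock setU1D// truncDblock. Qed.

Lemma setDblock_low K : (K :\: block ja) :\: low a = K :\: low a.+1.
Proof. by rewrite lowS setDDl setUC. Qed.

Lemma setDlow_block K : (K :\: low a) :\: block ja = K :\: low a.+1.
Proof. by rewrite lowS setDDl. Qed.

Lemma setDblockI K : (K :\: block ja) :&: low a = K :&: low a.
Proof.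
apply/setP=> u; rewrite !in_setI in_setD; case: (boolP (u \in low a)) => [/low_block->|] //.
by rewrite !andbF.
Qed.

Lemma setDlowI K : (K :\: low a) :&: block ja = K :&: block ja.
Proof.
apply/setP=> u; rewrite !in_setI in_setD; case: (boolP (u \in block ja)) => [/block_low->|] //.
by rewrite !andbF.
Qed.

Lemma cardI_lowS K : #|K :&: low a.+1| = (#|K :&: low a| + #|K :&: block ja|)%N.
Proof.
have E : (K :&: low a) :&: (K :&: block ja) = set0.
  by rewrite setIACA (disjoint_setI0 disjoint_low_block) setI0.
by rewrite lowS setIUr cardsU E cards0 subn0.
Qed.

Context (Q : pred {set 'I_N}) (g : 'rV[int]_k).
Hypothesis HQ : forall K, Q (K :\: low a.+1) ->
  forall j : 'I_k, (a.+1 <= j)%N -> mu 0 j <= (g - deg K) 0 j.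

(** A bigrading: [s] counts the variables of the earlier blocks and [i] those of the new block [ja].
    The support condition [F q] leaves the new block untruncated. *)
Let s K := #|K :&: low a|.
Let i K := #|K :&: block ja|.
Let F q K := [&& Q (K :\: low a.+1), s K + i K == q & trunc a g K]%N.

Let sUl v K : v \in low a -> v \notin K -> s (v |: K) = (s K).+1.
Proof. exact: card_setU1I. Qed.
Let iUb v K : v \in block ja -> v \notin K -> i (v |: K) = (i K).+1.
Proof. exact: card_setU1I. Qed.
Let sUb v K : v \in block ja -> s (v |: K) = s K.
Proof. by move=> vb; apply: cardU1_notin; rewrite block_low. Qed.
Let iUl v K : v \in low a -> i (v |: K) = i K.
Proof. by move=> vb; apply: cardU1_notin; rewrite low_block. Qed.
Let restU v K : v \in low a.+1 -> (v |: K) :\: low a.+1 = K :\: low a.+1.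
Proof. exact: setU1D. Qed.
Let lowW v : v \in low a -> v \in low a.+1.
Proof. by rewrite lowS in_setU => ->. Qed.
Let blockW v : v \in block ja -> v \in low a.+1.
Proof. by rewrite lowS in_setU orbC => ->. Qed.

Let gE K j : (g - deg K) 0 j = g 0 j - #|K :&: block j|%:Z.
Proof. by rewrite !mxE degE. Qed.

Let kdS z : koszul_d X (low a.+1) z = koszul_d X (low a) z + koszul_d X (block ja) z.
Proof. by rewrite lowS kdU// disjoint_low_block. Qed.

Let F_low q v K : v \in low a -> v \notin K -> F q.+1 (v |: K) -> F q K.
Proof.
move=> vl vK /and3P[QK sK tK]; rewrite /F -(restU _ (lowW vl)) QK.
rewrite sUl// iUl// addSn eqSS in sK; rewrite sK /=.
by apply: trunc_sub tK _; exact: subsetUr.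
Qed.

Let F_block q v K : v \in block ja -> v \notin K -> F q.+1 (v |: K) -> F q K.
Proof.
move=> vb vK /and3P[QK sK tK]; rewrite /F -(restU _ (blockW vb)) QK.
rewrite sUb// iUb// addnS eqSS in sK; rewrite sK /=.
by rewrite -(truncU1block _ _ vb).
Qed.

(** Filtration by [s]: the top layer of a cycle is a cycle for the block [ja], hence a boundary by
    [block_exact], and subtracting this boundary lowers [s]. *)
Lemma full_exact m q z : (1 <= g 0 ja - t 0 ja) ->
  kchain g (fun K => F q K && (s K < m)%N) z -> koszul_d X (low a.+1) z = 0 ->
  exists2 y, kchain g (F q.+1) y & z = koszul_d X (low a.+1) y.
Proof.
move=> ca; elim: m z => [|m IH] z zC dz.
  exists 0; first exact: kchain0.
  by rewrite raddf0; apply/ffunP=> K; rewrite ffunE (zC K).2// andbF.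
pose z' := krestrict (fun K => s K == m) z.
have zz' : kchain g (fun K => F q K && (s K < m)%N) (z - z').
  apply: kchain_sub (kchain_restrictB _ zC) => K /=.
  by case/andP=> sm /andP[-> /=]; move: sm; rewrite ?inE /=; lia.
have [qm|mq] := ltnP q m.
  apply: (IH z) => //; apply: kchain_sub zC => K /andP[FK sK]; rewrite FK /=.
  by case/and3P: FK => _ /eqP; lia.
pose Q' (L : {set 'I_N}) := [&& Q (L :\: low a), #|L :&: low a| == m & trunc a g L].
have Q'E K : Q' (K :\: block ja) = [&& Q (K :\: low a.+1), s K == m & trunc a g K].
  by rewrite /Q' setDblock_low setDblockI truncDblock.
(* At [s K = m] the earlier blocks could only contribute from [s = m + 1], where [z] is zero. *)
have dz' : koszul_d X (block ja) z' = 0.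
  apply/ffunP=> K; rewrite [RHS]ffunE; case: (eqVneq (s K) m) => sK; last first.
    by apply: koszul_d_eq0 => v vb vK; rewrite ffunE sUb// (negbTE sK).
  have /ffunP/(_ K) := dz; rewrite kdS !ffunE [X in X + _]koszul_d_eq0 ?add0r.
    by move=> <-; apply: koszul_d_eq => v vb vK; rewrite ffunE sUb// sK eqxx.
  by move=> v vl vK; apply: (zC _).2; rewrite sUl// sK ltnn andbF.
have [||y y_C yE] := block_exact (Q := Q') (i := (q - m)%N) (g := g) _ _ dz'.
- move=> K; rewrite Q'E => /and3P[QK _ /forallP tK] l.
  rewrite gE; have := mu_t l; have := n_gt0 l.
  case: (ltngtP l a) => la.
  + by have := implyP (tK l) la; lia.
  + by have := HQ QK la; rewrite gE; lia.
  (* All [n ja] variables may occur: [g > t] in this coordinate and [t >= mu + n - 1] still leave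
     [g - n >= mu]. *)
  + have -> : l = ja by exact: val_inj.
    have := subset_leq_card (subsetIr K (block ja)); rewrite card_block; lia.
- apply: kchain_sub (kchain_restrict _ zC) => K /=.
  case/andP=> /andP[/and3P[QK /eqP sK tK] _] sm; rewrite Q'E QK sm tK.
  by move: sm; rewrite ?inE /= => /eqP sm; rewrite andbT; apply/eqP; rewrite -/(i K); lia.
have yF : kchain g (F q.+1) y.
  apply: kchain_sub y_C => K /andP[/eqP iK]; rewrite Q'E => /and3P[QK /eqP sK tK].
  by rewrite /F QK tK andbT /=; apply/eqP; rewrite sK /i iK; lia.
have [||y2 y2F y2E] := IH (z - koszul_d X (low a.+1) y).
- have -> : z - koszul_d X (low a.+1) y = z - z' - koszul_d X (low a) y.
    by rewrite kdS -yE opprD addrA addrAC.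
  apply: kchainB zz' _; apply: kchain_koszul_d y_C => K v vl vK.
  move=> /andP[/eqP iK]; rewrite Q'E => /and3P[QK /eqP sK tK].
  rewrite (F_low vl vK); last first.
    by rewrite /F QK tK andbT /=; apply/eqP; rewrite sK /i iK; lia.
  by move: sK; rewrite sUl//; lia.
- by rewrite raddfB /= dz koszul_d_koszul_d subr0.
exists (y2 + y); first exact: kchainD.
by rewrite raddfD /= -y2E subrK.
Qed.

Hypothesis IHa : forall (Q' : pred {set 'I_N}) q z,
  (forall K, Q' (K :\: low a) ->
    forall j : 'I_k, (a <= j)%N -> mu 0 j <= (g - deg K) 0 j) ->
  q%:Z < \sum_(j < k | (j < a)%N) (g 0 j - t 0 j) ->
  kchain g (fun K => [&& Q' (K :\: low a), #|K :&: low a| == q & trunc a g K]) z ->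
  koszul_d X (low a) z = 0 ->
  exists2 y, kchain g (fun K => [&& Q' (K :\: low a), #|K :&: low a| == q.+1 & trunc a g K]) y
    & z = koszul_d X (low a) y.

Let sumS : \sum_(j < k | (j < a.+1)%N) (g 0 j - t 0 j) =
  \sum_(j < k | (j < a)%N) (g 0 j - t 0 j) + (g 0 ja - t 0 ja).
Proof.
rewrite (bigD1 ja) //= addrC; congr (_ + _); apply: eq_bigl => j.
by rewrite ltnS -val_eqE /= ltn_neqAle andbC.
Qed.

Let truncS K : trunc a.+1 g K = trunc a g K && (t 0 ja + (i K)%:Z <= g 0 ja).
Proof.
apply/forallP/andP => [h|[/forallP h ha] j].
  split; last exact: (implyP (h ja)).
  by apply/forallP=> j; apply/implyP=> ja'; apply: (implyP (h j)); exact: leqW.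
apply/implyP; rewrite ltnS leq_eqVlt => /orP[/eqP jE|]; last exact/implyP/h.
by have -> : j = ja by exact: val_inj.
Qed.

(* Modulo the truncation, the complex is exact in low degrees because the
   lower blocks are, so a chain with truncated boundary is homologous to a
   truncated one. *)
Lemma retract_to_truncation (c m q : nat) (y : chain) : g 0 ja = t 0 ja + c%:Z -> (0 < c)%N ->
  q%:Z < \sum_(j < k | (j < a.+1)%N) (g 0 j - t 0 j) ->
  kchain g (fun K => F q.+1 K && (i K < m)%N) y ->
  kchain g (fun K => F q K && (i K <= c)%N) (koszul_d X (low a.+1) y) ->
  exists u, kchain g (fun K => F q.+1 K && (i K <= c)%N) (y - koszul_d X (low a.+1) u).
Proof.
move=> gc c0 qS; elim: m y => [|m IH] y yC dyC.
  by exists 0; rewrite raddf0 subr0; apply: kchain_sub yC => K /andP[].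
have [mc|cm] := leqP m c.
  exists 0; rewrite raddf0 subr0; apply: kchain_sub yC => K /andP[-> /=]; lia.
pose y' := krestrict (fun K => i K == m) y.
have yy' : kchain g (fun K => F q.+1 K && (i K < m)%N) (y - y').
  apply: kchain_sub (kchain_restrictB _ yC) => K /=.
  by case/andP=> im /andP[-> /=]; move: im; rewrite ?inE /=; lia.
have [qm|mq] := ltnP q.+1 m.
  apply: (IH y) => //; apply: kchain_sub yC => K /andP[FK iK]; rewrite FK /=.
  by case/and3P: FK => _ /eqP; lia.
(* At [i K = m > c] the boundary of [y] vanishes by assumption, and block [ja] could only contribute
   from [i = m + 1], where [y] is zero. *)
have dy' : koszul_d X (low a) y' = 0.
  apply/ffunP=> K; rewrite [RHS]ffunE; case: (eqVneq (i K) m) => iK; last first.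
    by apply: koszul_d_eq0 => v vl vK; rewrite ffunE iUl// (negbTE iK).
  have := (dyC K).2; rewrite iK leqNgt cm andbF => /(_ isT).
  rewrite kdS ffunE [X in _ + X]koszul_d_eq0 ?addr0.
    by move=> <-; apply: koszul_d_eq => v vl vK; rewrite ffunE iUl// iK eqxx.
  by move=> v vb vK; apply: (yC _).2; rewrite iUb// iK ltnn andbF.
pose Q' (L : {set 'I_N}) := Q (L :\: block ja) && (#|L :&: block ja| == m).
have Q'E K : Q' (K :\: low a) = Q (K :\: low a.+1) && (i K == m).
  by rewrite /Q' setDlow_block setDlowI.
(* As [m > c], one has [q + 1 - m <= q - c], which lies below the sum over the earlier blocks. *)
have [|||u uC uE] := IHa (Q' := Q') (q := (q.+1 - m)%N) _ _ _ dy'.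
- move=> K; rewrite Q'E => /andP[QK /eqP iK] j; rewrite leq_eqVlt => /orP[/eqP aj|].
    have <- : ja = j by exact: val_inj.
    have := subset_leq_card (subsetIr K (block ja)); rewrite card_block gE gc.
    by have := mu_t ja; lia.
  by move=> aj; exact: HQ.
- by move: qS; rewrite sumS gc; lia.
- apply: kchain_sub (kchain_restrict _ yC) => K /=.
  case/andP=> /andP[/and3P[QK /eqP sK tK] _] im; rewrite Q'E QK tK andbT.
  by move: im; rewrite ?inE /= => /eqP im; rewrite im eqxx /=; apply/eqP; rewrite -/(s K); lia.
have [||u2 u2C] := IH (y - koszul_d X (low a.+1) u).
- have -> : y - koszul_d X (low a.+1) u = y - y' - koszul_d X (block ja) u.
    by rewrite kdS -uE opprD addrA.
  apply: kchainB yy' _; apply: kchain_koszul_d uC => K v vb vK.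
  rewrite Q'E => /and3P[/andP[QK /eqP iK] /eqP sK tK].
  rewrite (F_block vb vK); last first.
    by rewrite /F QK tK andbT /=; apply/eqP; rewrite iK /s sK; lia.
  by move: iK; rewrite iUb//; lia.
- by rewrite raddfB /= koszul_d_koszul_d subr0.
by exists (u + u2); rewrite raddfD opprD addrA.
Qed.

(** Let [c] be coordinate [ja] of [g - t]. If [c < 0] the complex is zero; if [c = 0] it is that of
    the earlier blocks; if [c > 0], [full_exact] gives an untruncated primitive, which
    [retract_to_truncation] corrects. *)
Lemma truncated_exact_step q z :
  q%:Z < \sum_(j < k | (j < a.+1)%N) (g 0 j - t 0 j) ->
  kchain g (fun K => [&& Q (K :\: low a.+1), #|K :&: low a.+1| == q & trunc a.+1 g K]) z ->
  koszul_d X (low a.+1) z = 0 ->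
  exists2 y, kchain g (fun K => [&& Q (K :\: low a.+1), #|K :&: low a.+1| == q.+1 &
      trunc a.+1 g K]) y
    & z = koszul_d X (low a.+1) y.
Proof.
move=> qS zC dz.
have CE q' K : [&& Q (K :\: low a.+1), #|K :&: low a.+1| == q' & trunc a.+1 g K] =
    F q' K && (t 0 ja + (i K)%:Z <= g 0 ja).
  by rewrite /F truncS cardI_lowS !andbA.
have [gt|tg] := ltrP (g 0 ja) (t 0 ja).
  exists 0; first exact: kchain0.
  rewrite raddf0; apply/ffunP=> K; rewrite ffunE (zC K).2// CE negb_and; apply/orP.
  by right; lia.
have [c gc] : exists c : nat, g 0 ja = t 0 ja + c%:Z.
  by exists `|(g 0 ja - t 0 ja)%R|%N; lia.
have zC' : kchain g (fun K => F q K && (i K <= c)%N) z.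
  by apply: kchain_sub zC => K; rewrite CE gc => /andP[-> /=]; lia.
suff [y yC yE] : exists2 y, kchain g (fun K => F q.+1 K && (i K <= c)%N) y
    & z = koszul_d X (low a.+1) y.
  exists y => //; apply: kchain_sub yC => K; rewrite CE gc => /andP[-> /=]; lia.
case: (posnP c) => [c0|c0]; last first.
  have [|||y yC yE] := full_exact (m := N.+1) (q := q) (z := z); first by lia.
  - apply: kchain_sub zC' => K /andP[-> _] /=.
    by rewrite ltnS -[X in (_ <= X)%N]card_ord -cardsT subset_leq_card// subsetT.
  - exact: dz.
  have [||u uC] := retract_to_truncation (m := N.+1) (y := y) gc c0 qS.
  - apply: kchain_sub yC => K -> /=.
    by rewrite ltnS -[X in (_ <= X)%N]card_ord -cardsT subset_leq_card// subsetT.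
  - by rewrite -yE.
  by exists (y - koszul_d X (low a.+1) u); rewrite // raddfB /= koszul_d_koszul_d subr0.
(* For [c = 0] no variable of block [ja] may occur, which is recorded as a condition on the inert
   variables. *)
pose Q' (L : {set 'I_N}) := Q (L :\: block ja) && (#|L :&: block ja| == 0)%N.
have Q'E K : Q' (K :\: low a) = Q (K :\: low a.+1) && (i K == 0)%N.
  by rewrite /Q' setDlow_block setDlowI.
have dz' : koszul_d X (low a) z = 0.
  apply/ffunP=> K; have /ffunP/(_ K) := dz; rewrite kdS ffunE => <-.
  rewrite [X in _ + X]koszul_d_eq0 ?addr0// => v vb vK.
  by apply: (zC' _).2; rewrite iUb// c0 andbF.
have [|||y yC yE] := IHa (Q' := Q') (q := q) _ _ _ dz'.
- move=> K; rewrite Q'E => /andP[QK /eqP iK] j; rewrite leq_eqVlt => /orP[/eqP aj|].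
    have <- : ja = j by exact: val_inj.
    rewrite gE gc c0 -/(i K) iK; have := mu_t ja; have := n_gt0 ja; lia.
  by move=> aj; exact: HQ.
- by move: qS; rewrite sumS gc; lia.
- apply: kchain_sub zC' => K /andP[/and3P[QK sK tK] iK].
  move: iK; rewrite c0 leqn0 => iK; rewrite Q'E QK iK tK andbT /=.
  by move: sK; rewrite (eqP iK) addn0 => ->.
exists y.
  apply: kchain_sub yC => K; rewrite Q'E => /and3P[/andP[QK /eqP iK] sK tK].
  by rewrite /F QK tK iK addn0 /= sK.
rewrite kdS -yE; apply/ffunP=> K; rewrite ffunE [X in _ + X]koszul_d_eq0 ?addr0// => v vb vK.
by apply: (yC _).2; rewrite Q'E iUb// andbF.
Qed.

End Step.

(** Induction on the number of blocks. The condition [Q] on the inert variables is general because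
    the step prescribes through it how many variables of the next block occur. *)
Theorem truncated_exact (a : nat) g (Q : pred {set 'I_N}) q z : (a <= k)%N ->
  (forall K, Q (K :\: low a) ->
    forall j : 'I_k, (a <= j)%N -> mu 0 j <= (g - deg K) 0 j) ->
  q%:Z < \sum_(j < k | (j < a)%N) (g 0 j - t 0 j) ->
  kchain g (fun K => [&& Q (K :\: low a), #|K :&: low a| == q & trunc a g K]) z ->
  koszul_d X (low a) z = 0 ->
  exists2 y, kchain g (fun K => [&& Q (K :\: low a), #|K :&: low a| == q.+1 & trunc a g K]) y
    & z = koszul_d X (low a) y.
Proof.
(* For [a = 0] the sum is empty and the bound [q < 0] is absurd. *)
elim: a Q q z => [|a IH] Q q z ak HQ qS zC dz; first by rewrite big_pred0 in qS.
apply: (truncated_exact_step ak HQ) => // Q' q' z'.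
by apply: IH; exact: ltnW.
Qed.

End Truncated.


(** * Regularity of the truncation *)

Section Standard.
Context (S : comNzRingType) (k : nat) (n : 'I_k -> nat).
Notation N := (\sum_(i < k) n i)%N.
Notation R := {mpoly S[N]}.
Implicit Types (p : stdring S n).

Lemma block_idealP j p : block_ideal S n j p ->
  exists a : 'I_N -> R, p = \sum_(v in block n j) a v * 'X_v.
Proof.
case=> a ->; exists (fun v : 'I_N => \sum_(l < n j | @tagnat.Rank _ n j l == v) a l).
under [RHS]eq_bigr => v _ do rewrite mulr_suml.
rewrite (exchange_big_dep predT) //=; apply: eq_bigr => l _.
rewrite (big_pred1 (@tagnat.Rank _ n j l)) // => v /=.
rewrite !inE; case: (eqVneq v (@tagnat.Rank _ n j l)) => [->|_]; last exact: andbF.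
by rewrite tagnat.Rank1K eqxx.
Qed.

Lemma m_idealP p : m_ideal S n p -> exists a : 'I_N -> R, p = \sum_v a v * 'X_v.
Proof.
case=> b bI ->; have /choice[a aE] j := block_idealP (bI j).
exists (fun v => a (tagnat.sig1 v) v).
rewrite (eq_bigr _ (fun j _ => aE j)) [RHS](partition_big (@tagnat.sig1 _ n) predT)//=.
apply: eq_bigr => j _; apply: eq_big => v; first by rewrite inE.
by rewrite inE => /eqP->.
Qed.

Lemma m_idealX v : m_ideal S n ('X_v : stdring S n).
Proof.
exists (fun i : 'I_k => if i == tagnat.sig1 v then 'X_v else 0 : stdring S n) => [i|].
  case: eqP => [->|_]; last first.
    by exists (fun=> 0); symmetry; apply: big1 => j _; rewrite mul0r.
  exists (fun j => (j == tagnat.sig2 v)%:R).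
  rewrite [RHS](bigD1 (tagnat.sig2 v))//= [X in _ + X]big1.
    by rewrite eqxx mul1r addr0 /Xvar tagnat.sig2K.
  by move=> j /negbTE->; rewrite mul0r.
by rewrite -[RHS]big_mkcond [RHS]big_pred1_eq.
Qed.

Lemma generator_mem (G : zmodType) (w : 'I_N -> G) I r (f : 'I_r -> R) :
  homogeneous_generators w I f -> forall i, I (f i).
Proof.
case=> _ -> i; exists (fun j => (j == i)%:R); rewrite [RHS](bigD1 i)//= eqxx mul1r.
by rewrite [X in _ + X]big1 ?addr0// => j /negbTE->; rewrite mul0r.
Qed.

Lemma orthantP (t g : 'rV[int]_k) : orthant t g <-> forall j, t 0 j <= g 0 j.
Proof.
split=> [[nu nu0 <-] j|h]; first by rewrite mxE lerDl; exact: nu0.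
exists (g - t); last by rewrite addrC subrK.
by move=> j; rewrite !mxE subr_ge0.
Qed.

End Standard.

(** * The Koszul complex of the truncation inside that of [M] *)

Section TruncationKoszul.
Context (S : comNzRingType) (k : nat) (n : 'I_k -> nat).
Notation N := (\sum_(i < k) n i)%N.
Notation R := {mpoly S[N]}.
Context (M : gradedModule S (multideg n)) (t : 'rV[int]_k).
Local Notation X := (fun v : 'I_N => 'X_v : R).
Local Notation T := (truncation M t).

Lemma truncation_support g (x : T) : hcomp T g x -> ~ orthant t g -> x = 0.
Proof.
move=> gx tg; apply: val_inj; rewrite raddf0.
have /asboolP xt := restr_valP x; exact: (hsum_hcomp (hcompP M) xt gx tg).
Qed.

Lemma total_truncation_support d (x : total_grading T) :
  hcomp (total_grading T) d x -> d < total_degree t -> x = 0.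
Proof.
case=> s [f fP ->] dt; rewrite [LHS]big_seq; apply: big1 => g gs; have [gd fg] := fP _ gs.
apply: truncation_support fg _ => /orthantP tg.
(* Coordinatewise, [t <= g] forces the total degree of [t] to be at most that of [g], which is
   [d]. *)
move: dt; rewrite -gd /= ltNge => /negP; apply; exact: ler_sum.
Qed.

Hypothesis truncated_exact : forall g q (z : {ffun {set 'I_N} -> M}),
  q%:Z + total_degree t < total_degree g ->
  kchain g (fun K => (#|K| == q) && trunc t k g K) z -> koszul_d X setT z = 0 ->
  exists2 y, kchain g (fun K => trunc t k g K) y & z = koszul_d X setT y.

Lemma truncP g K : trunc t k g K <-> orthant t (g - kdeg (multideg n) K).
Proof.
rewrite orthantP; split=> [/forallP h j|h].
  by have /implyP/(_ (ltn_ord j)) := h j; rewrite !mxE degE lerBrDr.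
by apply/forallP=> j; apply/implyP=> _; have := h j; rewrite !mxE degE; rewrite lerBrDr.
Qed.

(** By [truncP], [val] identifies the Koszul chains of the truncation in degree [g] with the chains
    of [M] supported on [trunc t k g]. *)
Lemma truncation_exact g q (z : {ffun {set 'I_N} -> T}) :
  q%:Z + total_degree t < total_degree g ->
  kchain g (fun K => #|K| == q) z -> koszul_d X setT z = 0 -> exists y, z = koszul_d X setT y.
Proof.
move=> qg zC dz.
have koszul_d_val (y : {ffun {set 'I_N} -> T}) :
    koszul_d X setT [ffun K => val (y K)] = [ffun K => val (koszul_d X setT y K)].
  apply/ffunP=> K; rewrite ffunE !kdE raddf_sum; apply: eq_bigr => v _.
  by rewrite ffunE.
have [||y yC yE] := truncated_exact (z := [ffun K => val (z K)]) qg.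
- move=> K; rewrite ffunE; have [hz z0] := zC K; split=> //.
  rewrite negb_and => /orP[/z0->|tK]; first by rewrite raddf0.
  rewrite (truncation_support hz) ?raddf0// => /truncP.
  by rewrite (negbTE tK).
- by rewrite koszul_d_val dz; apply/ffunP=> K; rewrite !ffunE raddf0.
have y_in K : y K \in in_restr (M := M) (@orthant_up k n t).
  have [hy y0] := yC K; apply/asboolP; have [tK|tK] := boolP (trunc t k g K).
    by apply: hsum1 hy; exact/truncP.
  by rewrite y0//; exact: hsum0.
exists [ffun K => insubd (0 : T) (y K)]; apply/ffunP=> K; apply: val_inj.
transitivity ([ffun K => val (z K)] K); first by rewrite ffunE.
rewrite yE; transitivity (koszul_d X setT [ffun L => val ([ffun K => insubd (0 : T) (y K)] L)] K).
  by congr (koszul_d X setT _ K); apply/ffunP=> L; rewrite !ffunE insubdK.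
by rewrite koszul_d_val ffunE.
Qed.

End TruncationKoszul.


(** * Koszul exactness under coarsening of the grading *)

Section CoarsenedKoszul.
Context (S : comNzRingType) (G H : zmodType) (N : nat) (w : 'I_N -> G) (w' : 'I_N -> H).
Context (phi : {additive G -> H}) (phiw : forall v, phi (w v) = w' v).
Context (M : gradedModule S w).
Notation R := {mpoly S[N]}.
Notation chain := {ffun {set 'I_N} -> M}.
Local Notation X := (fun v : 'I_N => 'X_v : R).
Implicit Types (K : {set 'I_N}) (z : chain).

Lemma phi_kdeg K : phi (kdeg w K) = kdeg w' K.
Proof. by rewrite /kdeg raddf_sum; apply: eq_bigr => v _; exact: phiw. Qed.

Lemma proj_coarse d g (x : M) : coarse (hcomp M) phi d x -> phi g <> d -> hproj M g x = 0.
Proof.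
move=> /(hsum_uniq (dd0 (hcompP M)) (ddB (hcompP M)))[s [f [us fP xE]]] gd.
rewrite /hproj (proj_unique (hcompP M) us _ xE) => [|h /fP[]//].
by case: ifP => // /fP[].
Qed.

Definition kproj g z : chain := [ffun K => hproj M (g - kdeg w K) (z K)].

Lemma kproj_koszul_d P g z : kproj g (koszul_d X P z) = koszul_d X P (kproj g z).
Proof.
apply/ffunP=> K; rewrite ffunE !kdE raddf_sum; apply: eq_bigr => v /andP[vP vK].
rewrite ffunE -(hprojZ (d := w v)) ?kdegU//.
  congr (hproj M _ _).
  by rewrite [RHS]addrC [w v + _]addrC opprD addrA subrK.
by rewrite -[w v]add0r; apply: homogeneousM; [exact: homogeneous_sgn|exact: homogeneousX].
Qed.

Lemma kproj_sum z : exists s : seq G, z = \sum_(g <- s) kproj g z.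
Proof.
have /choice[T TP] : forall K, exists s : seq G, uniq s /\ forall s', uniq s' ->
    {subset s <= s'} -> z K = \sum_(g <- s') hproj M g (z K).
  by move=> K; have [s us sE] := proj_supp (hcompP M) (z K); exists s.
pose s := undup (flatten [seq [seq g + kdeg w K | g <- T K] | K <- enum {: {set 'I_N}}]).
exists s; apply/ffunP=> K; rewrite sum_ffunE.
have [_ /(_ [seq g - kdeg w K | g <- s]) ->] := TP K.
- by rewrite big_map; apply: eq_bigr => g _; rewrite ffunE.
- by rewrite map_inj_uniq ?undup_uniq// => x y /addIr.
move=> g gT; apply/mapP; exists (g + kdeg w K); last by rewrite addrK.
rewrite mem_undup; apply/flatten_mapP; exists K; first by rewrite mem_enum.
exact: map_f.
Qed.

(** The differential commutes with the projections to the fine degrees, and a chain has finitely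
    many fine components; those with [phi g != d] vanish. *)
Lemma coarsen_exact (Q : pred {set 'I_N}) d z :
  (forall g (y : chain), phi g = d -> kchain g Q y -> koszul_d X setT y = 0 ->
     exists y', y = koszul_d X setT y') ->
  @kchain _ _ _ _ (coarsen phiw M) d Q z -> koszul_d X setT z = 0 ->
  exists y, z = koszul_d X setT y.
Proof.
move=> ex zC dz.
have /choice[y yE] : forall g, exists y, kproj g z = koszul_d X setT y.
  move=> g; case: (eqVneq (phi g) d) => [gd|gd].
    apply: (ex g) => // [K|].
      rewrite ffunE; split; first exact: proj_hcomp.
      by move=> /(zC K).2 ->; rewrite raddf0.
    by rewrite -kproj_koszul_d dz; apply/ffunP=> K; rewrite !ffunE raddf0.
  exists 0; rewrite raddf0; apply/ffunP=> K; rewrite !ffunE.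
  apply: (proj_coarse (zC K).1); rewrite raddfB phi_kdeg => /addIr.
  exact/eqP.
have [s zE] := kproj_sum z.
exists (\sum_(g <- s) y g); rewrite raddf_sum {1}zE.
by apply: eq_bigr => g _; exact: yE.
Qed.

End CoarsenedKoszul.

(** * Computation of the regularity *)

Local Open Scope classical_set_scope.

Theorem proposition1p3 (S : comNzRingType) (k : nat) (n : 'I_k -> nat)
  (k_gt0 : (0 < k)%N) (n_gt0 : forall i, (0 < n i)%N)
  (rB : nat) (gB : 'I_rB -> stdring S n)
  (gB_gen : homogeneous_generators (multideg n) (B_ideal S n) gB)
  (rm : nat) (gm : 'I_rm -> stdring S n)
  (gm_gen : homogeneous_generators (fun=> 1 : int) (m_ideal S n) gm)
  (M : gradedModule S (multideg n)) (mu : 'rV[int]_k)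
  (mu_notin : ~ star (cohomology_support M gB) mu)
  (t : 'rV[int]_k)
  (t_in : orthant (mu + \row_i ((n i)%:Z - 1)) t)
  (M_t_neq0 : exists x : truncation M t, x != 0) :
  regularity_is (total_grading (truncation M t)) gm (total_degree t).
Proof.
have mu_t i : mu 0 i + ((n i)%:Z - 1) <= t 0 i.
  by move/orthantP: t_in => /(_ i); rewrite !mxE.
have [/choice[dB hB] _] := gB_gen; have [/choice[dm hm] mE] := gm_gen.
(* Nonzero cohomology in a degree [g >= mu] would exhibit [mu] as [g - nu] in the star of the
   support. *)
have B_exact p (g : 'rV[int]_k) : (forall l, mu 0 l <= g 0 l) -> cech_exact M gB dB p g.
  move=> /orthantP[nu nu0 gE]; apply/(cech_exactP M hB) => hne; apply: mu_notin.
  by exists g; [exists p|exists nu; rewrite // -gE addrK].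
have block_exact j (Q : pred {set 'I_(\sum_(i < k) n i)}) i (g : 'rV[int]_k)
    (z : {ffun {set 'I_(\sum_(i < k) n i)} -> M}) :
  (forall K, Q (K :\: block n j) -> forall l, mu 0 l <= (g - kdeg (multideg n) K) 0 l) ->
  kchain g (fun K => (#|K :&: block n j| == i) && Q (K :\: block n j)) z ->
  koszul_d (fun v => 'X_v) (block n j) z = 0 ->
  exists2 y : {ffun {set 'I_(\sum_(i < k) n i)} -> M},
    kchain g (fun K => (#|K :&: block n j| == i.+1) && Q (K :\: block n j)) y
    & z = koszul_d (fun v => 'X_v) (block n j) y.
  (* The generators of [B] lie in every block ideal, so each is a combination of the variables of
     block [j] alone. *)
  move=> HQ; have /choice[a aE] : forall i, exists a : 'I_(\sum_(i < k) n i) -> stdring S n,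
      gB i = \sum_(v in block n j) a v * 'X_v.
    by move=> i'; apply: block_idealP; exact: (generator_mem gB_gen i').
  apply: (cech_to_koszul hB aE) => p K _ QK; apply: B_exact; exact: HQ.
have lowk : low n k = setT by apply/setP=> v; rewrite !inE ltn_ord.
have total_lt (q : nat) (g : 'rV[int]_k) : q%:Z + total_degree t < total_degree g ->
    q%:Z < \sum_(j < k | (j < k)%N) (g 0 j - t 0 j).
  move=> qg; rewrite (_ : \sum_(j < k | _) _ = total_degree g - total_degree t).
    by rewrite ltrBrDr.
  by rewrite /total_degree -sumrB; apply: eq_bigl => j; rewrite ltn_ord.
have tr_exact (g : 'rV[int]_k) (q : nat) (z : {ffun {set 'I_(\sum_(i < k) n i)} -> M}) :
    q%:Z + total_degree t < total_degree g ->
    kchain g (fun K => (#|K| == q) && trunc t k g K) z -> koszul_d (fun v => 'X_v) setT z = 0 ->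
    exists2 y : {ffun {set 'I_(\sum_(i < k) n i)} -> M},
      kchain g (fun K => trunc t k g K) y & z = koszul_d (fun v => 'X_v) setT y.
  move=> /total_lt qg zC; rewrite -lowk => dz.
  have [||y yC yE] := truncated_exact n_gt0 mu_t block_exact
    (Q := predT) (leqnn k) _ qg _ dz.
  - by move=> K _ j; rewrite leqNgt ltn_ord.
  - by apply: kchain_sub zC => K; rewrite lowk setIT.
  exists y => //; by apply: kchain_sub yC => K /and3P[].
set T := truncation M t; set tT := total_grading T.
have lin_koszul (q : nat) (d : int) (z : {ffun {set 'I_(\sum_(i < k) n i)} -> tT}) :
    kchain d (fun K => #|K| == q) z -> koszul_d (fun v => 'X_v) setT z = 0 ->
    q%:Z + total_degree t < d -> exists y, z = koszul_d (fun v => 'X_v) setT y.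
  move=> zC dz qd; apply: (coarsen_exact _ zC dz) => g y gd yC dy.
  by apply: (truncation_exact tr_exact _ yC dy); rewrite -gd in qd.
have /choice[am amE] : forall i, exists a : 'I_(\sum_(i < k) n i) -> stdring S n,
    gm i = \sum_v a v * 'X_v.
  by move=> i; apply: m_idealP; exact: (generator_mem gm_gen i).
have /choice[bm bmE] : forall v : 'I_(\sum_(i < k) n i), exists a : 'I_rm -> stdring S n,
    'X_v = \sum_i a i * gm i.
  by move=> v; have := m_idealX S v; rewrite mE.
split=> [e [p [d [ne ->]]]|u ub].
  rewrite leNgt; apply/negP=> pd; move: ne.
  exact/(cech_exactP tT hm)/(koszul_to_cech hm amE bmE lin_koszul).
rewrite leNgt; apply/negP=> ut.
(* An upper bound [u] below the total degree of [t] makes the cohomology vanish also where [p + d]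
   equals that degree. *)
have m_exact p d : total_degree t <= p%:Z + d -> cech_exact tT gm dm p d.
  move=> pd; apply/(cech_exactP tT hm) => ne.
  suff : p%:Z + d <= u by lia.
  by apply: ub; exists p, d.
(* The case [i = 0] of [cech_to_koszul] asks for vanishing at [p + (d - p) = d], so for [d] at least
   the total degree of [t] it writes [x] as a combination of the variables with coefficients of
   degree [d - 1]. These are zero by induction, starting below the support. *)
have vanish m : forall d (x : tT), d < total_degree t + m%:Z -> hcomp tT d x -> x = 0.
  elim: m => [|m IH] d x dm' dx.
    by apply: (total_truncation_support dx); rewrite addr0 in dm'.
  have [dlt|dge] := ltrP d (total_degree t); first exact: total_truncation_support dx dlt.
  pose z : {ffun {set 'I_(\sum_(i < k) n i)} -> tT} := [ffun K => if K == set0 then x else 0].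
  have amE' i : gm i = \sum_(v in (setT : {set 'I_(\sum_(i < k) n i)})) am i v * 'X_v.
    by rewrite amE; apply: eq_bigl => v; rewrite inE.
  have [|||y yC yE] := cech_to_koszul (M := tT) hm (Q := predT) (i := 0%N) (g := d) (z := z) amE'.
  - by move=> p K pK _; apply: m_exact; rewrite kdeg1 -[K]setIT pK; lia.
  - move=> K; rewrite ffunE setIT cards_eq0; case: eqP => [->|_]; last first.
      by split=> //; exact: (dd0 (hcompP tT)).
    by rewrite /kdeg big_set0 subr0.
  - apply/ffunP=> K; rewrite [RHS]ffunE; apply: koszul_d_eq0 => v _ vK.
    by rewrite ffunE -cards_eq0 cardsU1 vK.
  have -> : x = z set0 by rewrite ffunE eqxx.
  rewrite yE; apply: koszul_d_eq0 => v _ _.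
  apply: IH (yC _).1; rewrite kdeg1 cardsU1 inE cards0; lia.
have [x /eqP x0] := M_t_neq0; apply: x0.
have [s [f fP ->]] := dd_sum (hcompP tT) x; rewrite [LHS]big_seq; apply: big1 => d ds.
apply: (vanish `|d - total_degree t|.+1 d); last by have [] := fP d ds.
lia.
Qed.
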